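(* For every (discrete) groupoid $\mathcal{G}$, the Furstenberg boundary and the Hamana boundary coincide: $\partial_F\mathcal{G}=\partial_H\mathcal{G}$, i.e. they are $\mathcal{G}$-isomorphic as $\mathcal{G}$-spaces.
   Context: A groupoid $\mathcal{G}$ is regarded as discrete; $\mathcal{G}^{(0)}$ is its unit space, $r(g)=gg^{-1}$, $d(g)=g^{-1}g$, $gh$ is defined iff $d(g)=r(h)$, and $\mathcal{G}_u^v=\{g: d(g)=u,\ r(g)=v\}$. Dynamical systems. An operator system is a closed self-adjoint subspace of a unital $C^*$-algebra containing its unit; all c.p. maps are unital. A groupoid dynamical system $(\mathcal{G},\{A_u\}_{u\in\mathcal{G}^{(0)}},\alpha)$ consists of operator systems $A_u$ and complete order isomorphisms $\alpha_g:A_{d(g)}\to A_{r(g)}$ with $\alpha_g\alpha_h=\alpha_{gh}$ whenever $gh$ is defined. A $\mathcal{G}$-morphism to $(\mathcal{G},\{B_u\},\beta)$ is a family of c.p. maps $\varphi_u:A_u\to B_u$ with $\beta_g\varphi_{d(g)}=\varphi_{r(g)}\alpha_g$; it is a $\mathcal{G}$-injection (embedding) if every $\varphi_u$ is a complete order injection. A system $\mathcal{W}$ is $\mathcal{G}$-injective if for every $\mathcal{G}$-injection $\Phi:\mathcal{B}\to\mathcal{C}$ and $\mathcal{G}$-morphism $\Psi:\mathcal{B}\to\mathcal{W}$ there is a $\mathcal{G}$-morphism $\Theta:\mathcal{C}\to\mathcal{W}$ with $\Theta\circ\Phi=\Psi$. A $\mathcal{G}$-injective envelope of $\mathcal{A}$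 is a $\mathcal{G}$-injective system $\mathcal{W}$ with a $\mathcal{G}$-embedding $\Theta:\mathcal{A}\to\mathcal{W}$ that is $\mathcal{G}$-rigid (any $\mathcal{G}$-morphism $\Phi:\mathcal{W}\to\mathcal{W}$ with $\Phi\circ\Theta=\Theta$ is the identity); it exists and is unique up to $\mathcal{G}$-isomorphism. $\mathcal{G}$-spaces. All topological spaces are nonempty, compact and Hausdorff. A $\mathcal{G}$-space is a bundle $\mathcal{X}=\{X_u\}_{u\in\mathcal{G}^{(0)}}$ of spaces with homeomorphisms $x\mapsto g\cdot x$, $X_{d(g)}\to X_{r(g)}$, such that units act as identities and $g\cdot(h\cdot x)=(gh)\cdot x$. A $\mathcal{G}$-subspace is a family of compact nonempty $Y_u\subseteq X_u$ with $g\cdot Y_{d(g)}=Y_{r(g)}$. A $\mathcal{G}$-map is a family of continuous maps $\phi_u:X_u\to Y_u$ with $g\cdot\phi_{d(g)}(x)=\phi_{r(g)}(g\cdot x)$; a $\mathcal{G}$-isomorphism is a $\mathcal{G}$-map all of whose components are homeomorphisms. $P(X)$ denotes Radon probability measures with the weak$^*$-topology, $X\subseteq P(X)$ via point masses, and $(g\cdot\mu)(E)=\mu(g^{-1}\cdot E)$. $\mathcal{X}$ is minimal if its only $\mathcal{G}$-subspace is itself; strongly proximal if $\overline{\mathcal{G}_u^v\cdot\mu}\cap X_v\ne\emptyset$ whenever $\mathcal{G}_u^v\neq\emptyset$ and $\mu\in P(X_u)$; a $\mathcal{G}$-boundary if it is minimal and strongly proximal. The Furstenberg boundary $\partial_F\mathcal{G}$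 is the (unique up to $\mathcal{G}$-isomorphism) $\mathcal{G}$-boundary which maps onto every $\mathcal{G}$-boundary by a fibrewise surjective $\mathcal{G}$-map. Hamana boundary. The trivial system has fibres $C_u=\mathbb{C}$ and all $\gamma_g=\mathrm{id}$. Its $\mathcal{G}$-injective envelope is of the form $(\mathcal{G},\{C(\partial_H^u)\}_{u\in\mathcal{G}^{(0)}},\beta)$ with $\partial_H^u$ compact Hausdorff and $\beta_g$ $*$-isomorphisms. The Hamana boundary is $\partial_H\mathcal{G}=\{\partial_H^u\}_{u}$ with the $\mathcal{G}$-space structure determined by $\beta_g(f)(x)=f(g^{-1}\cdot x)$ for $f\in C(\partial_H^{d(g)})$, $x\in\partial_H^{r(g)}$. *)

(* Defs.v *)
From HB Require Import structures.
From mathcomp Require Import all_boot all_order all_algebra.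
From mathcomp Require Import all_classical all_reals all_analysis.
From mathcomp Require Import complex ring.

Set Implicit Arguments.
Unset Strict Implicit.
Unset Printing Implicit Defensive.

Import Order.TTheory GRing.Theory Num.Theory numFieldNormedType.Exports.

Local Open Scope classical_set_scope.
Local Open Scope ring_scope.

(* The product is a field of the mixin rather than a ring structure because the
   hierarchy has no join of rings and normed Z-modules below numDomainType. *)
HB.mixin Record isCStarAlgebra (K : numClosedFieldType) A
    of CompleteNormedModule K A := {
  cone : A;
  cmul : A -> A -> A;
  star : A -> A;
  cmulA : associative cmul;
  cmul1l : left_id cone cmul;
  cmul1r : right_id cone cmul;
  cmulDl : left_distributive cmul +%R;
  cmulDr : right_distributive cmul +%R;
  cmulZl : forall (c : K) x y, cmul (c *: x) y = c *: cmul x y;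
  cmulZr : forall (c : K) x y, cmul x (c *: y) = c *: cmul x y;
  starD : {morph star : x y / x + y};
  starZ : forall (c : K) x, star (c *: x) = c^* *: star x;
  starM : forall x y, star (cmul x y) = cmul (star y) (star x);
  starK : involutive star;
  norm_cmul : forall x y : A, `|cmul x y| <= `|x| * `|y|;
  norm_star_cmul : forall x : A, `|cmul (star x) x| = `|x| ^+ 2
}.

#[short(type="cstarAlgType")]
HB.structure Definition CStarAlgebra (K : numClosedFieldType) :=
  {A of CompleteNormedModule K A & isCStarAlgebra K A}.

(* The point only records that the space is nonempty; maps need not preserve it. *)
HB.mixin Record isCompHaus X of PointedTopological X := {
  compactT : compact [set: X];
  hausdorffT : hausdorff_space X
}.

#[short(type="compHausType")]
HB.structure Definition CompHaus :=
  {X of PointedTopological X & isCompHaus X}.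

Section complex_cstar.
Variable R : realType.

HB.instance Definition _ := GRing.ComAlgebra.copy R[i] (R[i]^o).
HB.instance Definition _ := NormedModule.copy R[i] (R[i]^o).

Lemma le_Re_norm (z : R[i]) : `|complex.Re z|%:C%C <= `|z|.
Proof.
rewrite normc_def lecR -sqrtr_sqr; apply: ler_wsqrtr.
by rewrite lerDl sqr_ge0.
Qed.

Lemma le_Im_norm (z : R[i]) : `|complex.Im z|%:C%C <= `|z|.
Proof.
rewrite normc_def lecR -sqrtr_sqr; apply: ler_wsqrtr.
by rewrite lerDr sqr_ge0.
Qed.

Lemma le_norm_ReIm (z : R[i]) : `|z| <= (`|complex.Re z| + `|complex.Im z|)%:C%C.
Proof.
rewrite normc_def lecR -[leRHS]ger0_norm ?addr_ge0 // -sqrtr_sqr.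
apply: ler_wsqrtr; rewrite sqrrD !real_normK ?num_real //.
by rewrite lerD2r lerDl mulrn_wge0 // mulr_ge0.
Qed.

Lemma complex_gt0 (e : R[i]) : 0 < e -> exists2 r : R, 0 < r & e = r%:C%C.
Proof.
case: e => a b; rewrite ltcE /= => /andP[/eqP -> a0]; by exists a.
Qed.

Lemma ReB (x y : R[i]) : complex.Re (x - y) = complex.Re x - complex.Re y.
Proof. by case: x y => ? ? [? ?]. Qed.

Lemma ImB (x y : R[i]) : complex.Im (x - y) = complex.Im x - complex.Im y.
Proof. by case: x y => ? ? [? ?]. Qed.

Lemma Re_continuous : continuous (@complex.Re R : R[i] -> R).
Proof.
move=> z; apply/(@cvgrPdist_lt _ R R[i] (nbhs z) (nbhs_filter z)) => e e0.
have e0' : 0 < e%:C%C :> R[i] by rewrite ltcR.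
apply: filterS (nbhsx_ballx z _ e0') => w; rewrite -ball_normE /ball_ /= => zw.
by rewrite -ReB -ltcR; apply: (le_lt_trans (le_Re_norm _)).
Qed.

Lemma cauchyC (F : set_system R[i]) (FF : ProperFilter F) (h : R[i] -> R) :
  (forall x y, `|h x - h y|%:C%C <= `|x - y|) -> cauchy F -> cauchy (h @ F).
Proof.
move=> hle /cauchyP Fc; apply/cauchyP => e e0.
have e0' : 0 < e%:C%C :> R[i] by rewrite ltcR.
have [x Fx] := Fc _ e0'.
exists (h x); suff : F (h @^-1` ball (h x) e) by [].
apply: filterS Fx => y.
rewrite /preimage /= -!ball_normE /ball_ /= => xy.
by have := le_lt_trans (hle x y) xy; rewrite ltcR.
Qed.

Lemma complex_complete (F : set_system R[i]) :
  ProperFilter F -> cauchy F -> cvg F.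
Proof.
move=> FF Fc.
have hR (x y : R[i]) : `|complex.Re x - complex.Re y|%:C%C <= `|x - y|.
  by have := le_Re_norm (x - y); rewrite ReB.
have hI (x y : R[i]) : `|complex.Im x - complex.Im y|%:C%C <= `|x - y|.
  by have := le_Im_norm (x - y); rewrite ImB.
have /R_complete /cvg_ex[a Ha] := cauchyC FF hR Fc.
have /R_complete /cvg_ex[b Hb] := cauchyC FF hI Fc.
apply/cvg_ex; exists (Complex a b).
apply/(@cvgrPdist_lt _ R[i] _ F) => _ /complex_gt0[e e0 ->].
have e20 : 0 < e / 2 by rewrite divr_gt0.
move/cvgrPdist_lt : Ha => /(_ _ e20) Ha.
move/cvgrPdist_lt : Hb => /(_ _ e20) Hb.
near=> z.
apply: (le_lt_trans (le_norm_ReIm _)); rewrite ltcR ReB ImB /= (splitr e).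
by apply: ltrD; near: z.
Unshelve. all: by end_near. Qed.

HB.instance Definition _ := Uniform_isComplete.Build R[i] complex_complete.

Let mulZl (c x y : R[i]) : (c *: x) * y = c *: (x * y).
Proof. by rewrite scalerAl. Qed.
Let mulZr (c x y : R[i]) : x * (c *: y) = c *: (x * y).
Proof. by rewrite scalerAr. Qed.
Let conjD : {morph (@Num.conj_op R[i]) : x y / x + y}.
Proof. exact: rmorphD. Qed.
Let conjZ (c x : R[i]) : (c *: x)^* = c^* *: x^*.
Proof. exact: rmorphM. Qed.
Let conjM (x y : R[i]) : (x * y)^* = y^* * x^*.
Proof. by rewrite rmorphM mulrC. Qed.
Let normM (x y : R[i]) : `|x * y| <= `|x| * `|y|.
Proof. by rewrite normrM. Qed.
Let norm_conjM (x : R[i]) : `|x^* * x| = `|x| ^+ 2.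
Proof. by rewrite normrM norm_conjC expr2. Qed.

HB.instance Definition _ := isCStarAlgebra.Build R[i] R[i]
  (@mulrA _) (@mul1r _) (@mulr1 _) (@mulrDl _) (@mulrDr _) mulZl mulZr
  conjD conjZ conjM (@conjCK _) normM norm_conjM.
End complex_cstar.

Record Cfun (R : realType) (X : compHausType) := MkCfun {
  Cfun_fun :> X -> R[i];
  Cfun_continuous : continuous Cfun_fun
}.

HB.instance Definition _ (R : realType) (X : compHausType) :=
  gen_eqMixin (Cfun R X).
HB.instance Definition _ (R : realType) (X : compHausType) :=
  gen_choiceMixin (Cfun R X).

Section Cfun.
Variables (R : realType) (X : compHausType).
Implicit Types (f g h : Cfun R X) (c : R[i]).

Lemma CfunP f g : (forall x, f x = g x) -> f = g.
Proof.
case: f g => [f cf] [g cg] /= /funext fg; rewrite fg in cf *.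
by congr MkCfun; exact: Prop_irrelevance.
Qed.

Lemma conj_continuous : continuous (@Num.conj_op R[i]).
Proof.
move=> z; apply/(@cvgrPdist_lt _ R[i] R[i] (nbhs z) (nbhs_filter z)) => e e0.
apply: filterS (nbhsx_ballx z _ e0) => w; rewrite -ball_normE /ball_ /= => zw.
by rewrite -rmorphB norm_conjC.
Qed.

Lemma Cadd_cont f g : continuous (fun x => f x + g x).
Proof. by move=> x; apply: cvgD; exact: Cfun_continuous. Qed.
Lemma Copp_cont f : continuous (fun x => - f x).
Proof. by move=> x; apply: cvgN; exact: Cfun_continuous. Qed.
Lemma Cmul_cont f g : continuous (fun x => f x * g x).
Proof. by move=> x; apply: cvgM; exact: Cfun_continuous. Qed.
Lemma Ccst_cont c : continuous (fun _ : X => c).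
Proof. by move=> x; exact: cvg_cst. Qed.
Lemma Cscale_cont c f : continuous (fun x => c * f x).
Proof. by move=> x; apply: cvgM; [exact: cvg_cst|exact: Cfun_continuous]. Qed.
Lemma Cconj_cont f : continuous (fun x => (f x)^*).
Proof.
move=> x; apply: (@continuous_comp _ _ _ f (@Num.conj_op R[i])).
  exact: Cfun_continuous.
exact: conj_continuous.
Qed.

Definition Cadd f g := MkCfun (@Cadd_cont f g).
Definition Copp f := MkCfun (@Copp_cont f).
Definition Czero := MkCfun (@Ccst_cont 0).
Definition Cone := MkCfun (@Ccst_cont 1).
Definition Cmul f g := MkCfun (@Cmul_cont f g).
Definition Cscale c f := MkCfun (@Cscale_cont c f).
Definition Cconj f := MkCfun (@Cconj_cont f).

Lemma CaddA : associative Cadd.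
Proof. by move=> f g h; apply: CfunP => x; rewrite /= addrA. Qed.
Lemma CaddC : commutative Cadd.
Proof. by move=> f g; apply: CfunP => x; rewrite /= addrC. Qed.
Lemma Cadd0 : left_id Czero Cadd.
Proof. by move=> f; apply: CfunP => x; rewrite /= add0r. Qed.
Lemma CaddN : left_inverse Czero Copp Cadd.
Proof. by move=> f; apply: CfunP => x; rewrite /= addNr. Qed.

HB.instance Definition _ :=
  GRing.isZmodule.Build (Cfun R X) CaddA CaddC Cadd0 CaddN.

Lemma CscaleA c d f : Cscale c (Cscale d f) = Cscale (c * d) f.
Proof. by apply: CfunP => x; rewrite /= mulrA. Qed.
Lemma Cscale1 : left_id 1 Cscale.
Proof. by move=> f; apply: CfunP => x; rewrite /= mul1r. Qed.
Lemma CscaleDr : right_distributive Cscale +%R.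
Proof. by move=> c f g; apply: CfunP => x; rewrite /= mulrDr. Qed.
Lemma CscaleDl f : {morph Cscale^~ f : c d / c + d}.
Proof. by move=> c d; apply: CfunP => x; rewrite /= mulrDl. Qed.

HB.instance Definition _ :=
  GRing.Zmodule_isLmodule.Build R[i] (Cfun R X) CscaleA Cscale1 CscaleDr CscaleDl.

Lemma CaddE f g x : (f + g) x = f x + g x. Proof. by []. Qed.
Lemma CsubE f g x : (f - g) x = f x - g x. Proof. by []. Qed.
Lemma CscaleE c f x : (c *: f) x = c * f x. Proof. by []. Qed.

Definition Csup f : R := sup (range (fun x => complex.Re `|f x|)).
Definition Cnorm f : R[i] := (Csup f)%:C%C.

Lemma ReK (z : R[i]) : (complex.Re `|z|)%:C%C = `|z|.
Proof. by rewrite RRe_real// normr_real. Qed.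

Lemma Cmax f : exists x0, forall x, `|f x| <= `|f x0|.
Proof.
have cf : continuous (fun x => complex.Re `|f x|).
  move=> x; apply: (@continuous_comp _ _ _ (fun x => `|f x|) (@complex.Re R)).
    by apply: cvg_norm; exact: Cfun_continuous.
  exact: Re_continuous.
have X0 : [set: X] !=set0 by exists point.
have cfT : {within [set: X], continuous (fun x => complex.Re `|f x|)}.
  exact: continuous_subspaceT.
have [x0 _ xM] := compact_EVT_max X0 (@compactT X) cfT.
exists x0 => x; rewrite -[leLHS]ReK -[leRHS]ReK lecR.
by apply: xM; rewrite inE.
Qed.

Lemma CnormP f : exists2 x0, Cnorm f = `|f x0| & forall x, `|f x| <= `|f x0|.
Proof.
have [x0 fx0] := Cmax f; exists x0 => //.
rewrite /Cnorm -[RHS]ReK; congr (_ %:C)%C; apply/eqP.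
rewrite eq_le; apply/andP; split.
  apply: ge_sup; first by exists (complex.Re `|f x0|), x0.
  by move=> _ [x _ <-]; rewrite -lecR !ReK.
apply: sup_upper_bound; last by exists x0.
split; first by exists (complex.Re `|f x0|), x0.
by exists (complex.Re `|f x0|) => _ [x _ <-]; rewrite -lecR !ReK.
Qed.

Lemma le_Cnorm f x : `|f x| <= Cnorm f.
Proof. by have [x0 ->] := CnormP f. Qed.

Lemma Cnorm_le f c : (forall x, `|f x| <= c) -> Cnorm f <= c.
Proof. by have [x0 -> _] := CnormP f. Qed.

Lemma Cnorm_lt f c : (forall x, `|f x| < c) -> Cnorm f < c.
Proof. by have [x0 -> _] := CnormP f. Qed.

Lemma CnormD f g : Cnorm (f + g) <= Cnorm f + Cnorm g.
Proof.
apply: Cnorm_le => x; rewrite CaddE; apply: (le_trans (ler_normD _ _)).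
by apply: lerD; exact: le_Cnorm.
Qed.

Lemma CnormZ c f : Cnorm (c *: f) = `|c| * Cnorm f.
Proof.
have [x0 f0 f0M] := CnormP f; have [x1 f1 f1M] := CnormP (c *: f).
apply/eqP; rewrite eq_le f1 f0 CscaleE normrM ler_wpM2l //=.
by have := f1M x0; rewrite !CscaleE !normrM.
Qed.

Lemma Cnorm0_eq0 f : Cnorm f = 0 -> f = 0.
Proof.
move=> f0; apply: CfunP => x; apply/eqP; rewrite -normr_le0 -f0.
exact: le_Cnorm.
Qed.

HB.instance Definition _ :=
  Lmodule_isNormed.Build R[i] (Cfun R X) CnormD CnormZ Cnorm0_eq0.

Lemma CnormE f : `|f| = Cnorm f. Proof. by []. Qed.


Lemma Cfun_complete (F : set_system (Cfun R X)) :
  ProperFilter F -> cauchy F -> cvg F.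
Proof.
move=> FF /cauchyP Fc.
pose ev x (f : Cfun R X) : R[i] := f x.
have evB x f g : `|ev x f - ev x g| <= `|f - g|.
  by have := le_Cnorm (f - g) x.
have evc x : cvg (ev x @ F).
  apply: cauchy_cvg; apply/cauchyP => e e0; have [f Ff] := Fc _ e0.
  exists (ev x f); suff : F (ev x @^-1` ball (ev x f) e) by [].
  apply: filterS Ff => g; rewrite /preimage /= -!ball_normE /ball_ /=.
  exact: le_lt_trans (evB _ _ _).
pose l x : R[i] := lim (ev x @ F).
have evl x : ev x @ F --> l x by exact: evc.
have lF (e : R[i]) : 0 < e ->
    \forall f \near F, forall x, `|l x - ev x f| <= e.
  move=> e0; have e20 : 0 < e / 2 by rewrite divr_gt0.
  have [f Ff] := Fc _ e20.
  have lf x : `|l x - ev x f| <= e / 2.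
    apply/ler_addgt0Pl => d d0.
    have Fd : F [set g | `|l x - ev x g| < d].
      by move/(@cvgrPdist_lt _ R[i] _ F) : (evl x) => /(_ _ d0).
    have [g [Fg /= gd]] := filter_ex (filterI Ff Fd).
    apply: (le_trans (ler_distD (ev x g) _ _)); apply: lerD; first exact: ltW.
    rewrite distrC; apply: (le_trans (evB _ _ _)).
    by move: Fg; rewrite -ball_normE /ball_ /=; exact: ltW.
  apply: filterS Ff => g; rewrite -ball_normE /ball_ /= => fg x.
  apply: (le_trans (ler_distD (ev x f) _ _)); rewrite (splitr e).
  by apply: lerD; rewrite ?lf //; apply: (le_trans (evB _ _ _)); exact: ltW.
have lc : continuous l.
  move=> x; apply/(@cvgrPdist_le _ R[i] X (nbhs x) (nbhs_filter x)) => e e0.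
  have e30 : 0 < e / 3 by rewrite divr_gt0.
  have [f fl] := filter_ex (lF _ e30).
  have /(@cvgrPdist_le _ R[i] X (nbhs x) (nbhs_filter x)) /(_ _ e30) :=
    @Cfun_continuous _ _ f x.
  apply: filterS => y fxy.
  apply: (le_trans (ler_distD (f x) _ _)).
  have -> : e = e / 3 + (e / 3 + e / 3) by field.
  apply: lerD; first exact: fl.
  apply: (le_trans (ler_distD (f y) _ _)); apply: lerD => //.
  by rewrite distrC; exact: fl.
apply/cvg_ex; exists (MkCfun lc).
apply/(@cvgrPdist_le _ (Cfun R X) _ F) => e e0.
by apply: filterS (lF _ e0) => f fl; apply: Cnorm_le => x; exact: fl.
Qed.

HB.instance Definition _ := Uniform_isComplete.Build (Cfun R X) Cfun_complete.

Lemma CmulA : associative Cmul.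
Proof. by move=> f g h; apply: CfunP => x; rewrite /= mulrA. Qed.
Lemma Cmul1l : left_id Cone Cmul.
Proof. by move=> f; apply: CfunP => x; rewrite /= mul1r. Qed.
Lemma Cmul1r : right_id Cone Cmul.
Proof. by move=> f; apply: CfunP => x; rewrite /= mulr1. Qed.
Lemma CmulDl : left_distributive Cmul +%R.
Proof. by move=> f g h; apply: CfunP => x; rewrite /= mulrDl. Qed.
Lemma CmulDr : right_distributive Cmul +%R.
Proof. by move=> f g h; apply: CfunP => x; rewrite /= mulrDr. Qed.
Lemma CmulZl c f g : Cmul (c *: f) g = c *: Cmul f g.
Proof. by apply: CfunP => x; rewrite /= mulrA. Qed.
Lemma CmulZr c f g : Cmul f (c *: g) = c *: Cmul f g.
Proof. by apply: CfunP => x; rewrite /= mulrCA. Qed.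
Lemma CconjD : {morph Cconj : f g / f + g}.
Proof. by move=> f g; apply: CfunP => x; rewrite /= rmorphD. Qed.
Lemma CconjZ c f : Cconj (c *: f) = c^* *: Cconj f.
Proof. by apply: CfunP => x; rewrite /= rmorphM. Qed.
Lemma CconjM f g : Cconj (Cmul f g) = Cmul (Cconj g) (Cconj f).
Proof. by apply: CfunP => x; rewrite /= rmorphM mulrC. Qed.
Lemma CconjK : involutive Cconj.
Proof. by move=> f; apply: CfunP => x; rewrite /= conjCK. Qed.
Lemma CnormM f g : `|Cmul f g| <= `|f| * `|g|.
Proof.
apply: Cnorm_le => x; rewrite normrM.
by apply: ler_pM => //; exact: le_Cnorm.
Qed.
Lemma Cnorm_conjM f : `|Cmul (Cconj f) f| = `|f| ^+ 2.
Proof.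
have [x0 f0 f0M] := CnormP f; apply/eqP; rewrite eq_le; apply/andP; split.
  apply: (le_trans (CnormM _ _)); rewrite expr2 ler_wpM2r //.
  by apply: Cnorm_le => x; rewrite norm_conjC; exact: le_Cnorm.
rewrite [`|f|]f0.
have := le_Cnorm (Cmul (Cconj f) f) x0.
by rewrite /= normrM norm_conjC -expr2.
Qed.

HB.instance Definition _ := isCStarAlgebra.Build R[i] (Cfun R X)
  CmulA Cmul1l Cmul1r CmulDl CmulDr CmulZl CmulZr
  CconjD CconjZ CconjM CconjK CnormM Cnorm_conjM.

End Cfun.

(* [arrow u v] is G_u^v, the set of g with d(g) = u and r(g) = v, and [gcomp g h]
   is gh; the groupoid itself is the disjoint union of the [arrow u v]. *)
Record groupoid := Groupoid {
  unit_space :> Type;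
  arrow : unit_space -> unit_space -> Type;
  gunit : forall u, arrow u u;
  gcomp : forall u v w, arrow v w -> arrow u v -> arrow u w;
  ginv : forall u v, arrow u v -> arrow v u;
  gcompA : forall u v w z (k : arrow w z) (g : arrow v w) (h : arrow u v),
    gcomp k (gcomp g h) = gcomp (gcomp k g) h;
  gcomp1l : forall u v (g : arrow u v), gcomp (gunit v) g = g;
  gcomp1r : forall u v (g : arrow u v), gcomp g (gunit u) = g;
  gcompVl : forall u v (g : arrow u v), gcomp (ginv g) g = gunit u;
  gcompVr : forall u v (g : arrow u v), gcomp g (ginv g) = gunit v
}.

Lemma ginv_unique (G : groupoid) (u v : G) (g : arrow u v) (h : arrow v u) :
  gcomp h g = gunit u -> h = ginv g.
Proof.
by move=> hg; rewrite -[LHS]gcomp1r -(gcompVr g) gcompA hg gcomp1l.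
Qed.

Lemma ginvK (G : groupoid) (u v : G) (g : arrow u v) : ginv (ginv g) = g.
Proof. by apply/esym/ginv_unique; rewrite gcompVr. Qed.

Lemma ginvM (G : groupoid) (u v w : G) (g : arrow v w) (h : arrow u v) :
  ginv (gcomp g h) = gcomp (ginv h) (ginv g).
Proof.
apply/esym/ginv_unique.
by rewrite -gcompA [gcomp (ginv g) _]gcompA gcompVl gcomp1l gcompVl.
Qed.

(* M is positive in the C*-algebra M_n(A): M = B^* B for some B in M_n(A). *)
Definition mx_pos (K : numClosedFieldType) (A : cstarAlgType K) n
    (M : 'M[A]_n) : Prop :=
  exists B : 'M[A]_n,
    forall i j, M i j = \sum_(k < n) cmul (star (B k i)) (B k j).

(* An operator system is the subset [os_set] of its ambient C*-algebra.  Maps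
   between operator systems are represented by functions on the ambient
   algebras, of which only the restriction to [os_set] is ever used. *)
Record opsys (R : realType) := OpSys {
  os_alg : cstarAlgType R[i];
  os_set : set os_alg;
  os_closed : closed os_set;
  os_one : os_set cone;
  os_add : forall x y, os_set x -> os_set y -> os_set (x + y);
  os_scale : forall (c : R[i]) x, os_set x -> os_set (c *: x);
  os_star : forall x, os_set x -> os_set (star x)
}.

Arguments os_set {R} o _.

Section OperatorSystems.
Variable R : realType.
Implicit Types S T : opsys R.

Record ucp S T (f : os_alg S -> os_alg T) : Prop := {
  ucp_fun : forall x, os_set S x -> os_set T (f x);
  ucp_add : forall x y, os_set S x -> os_set S y -> f (x + y) = f x + f y;
  ucp_scale : forall (c : R[i]) x, os_set S x -> f (c *: x) = c *: f x;
  ucp_one : f cone = cone;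
  ucp_pos : forall n (M : 'M[os_alg S]_n),
    (forall i j, os_set S (M i j)) -> mx_pos M -> mx_pos (map_mx f M)
}.

Arguments ucp : clear implicits.

Record complete_order_injection S T (f : os_alg S -> os_alg T) : Prop := {
  coi_ucp : ucp S T f;
  coi_inj : forall x y, os_set S x -> os_set S y -> f x = f y -> x = y;
  coi_pos : forall n (M : 'M[os_alg S]_n),
    (forall i j, os_set S (M i j)) -> mx_pos (map_mx f M) -> mx_pos M
}.

Arguments complete_order_injection : clear implicits.

Definition complete_order_iso S T (f : os_alg S -> os_alg T) : Prop :=
  ucp S T f /\
  exists2 g : os_alg T -> os_alg S, ucp T S g &
    (forall x, os_set S x -> g (f x) = x) /\
    (forall y, os_set T y -> f (g y) = y).

Arguments complete_order_iso : clear implicits.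

Definition full_opsys (A : cstarAlgType R[i]) : opsys R :=
  @OpSys R A setT closedT I (fun _ _ _ _ => I) (fun _ _ _ => I) (fun _ _ => I).

Lemma star_hom_ucp (A B : cstarAlgType R[i]) (f : A -> B) :
  {morph f : x y / x + y} -> (forall (c : R[i]) x, f (c *: x) = c *: f x) ->
  f cone = cone -> {morph f : x y / cmul x y >-> cmul x y} ->
  {morph f : x / star x >-> star x} ->
  ucp (full_opsys A) (full_opsys B) f.
Proof.
move=> fD fZ f1 fM fS; split=> // n M _ [N MN].
have f0 : f 0 = 0 by rewrite -(scale0r (0 : A)) fZ scale0r.
exists (map_mx f N) => i j; rewrite mxE MN (big_morph f fD f0).
by apply: eq_bigr => k _; rewrite !mxE fM fS.
Qed.

End OperatorSystems.

Arguments ucp {R} S T f.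
Arguments complete_order_injection {R} S T f.
Arguments complete_order_iso {R} S T f.

Record gsystem (R : realType) (G : groupoid) := GSystem {
  sys_fib :> G -> opsys R;
  sys_act : forall u v, arrow u v -> os_alg (sys_fib u) -> os_alg (sys_fib v);
  sys_act_iso : forall u v (g : arrow u v),
    complete_order_iso (sys_fib u) (sys_fib v) (sys_act g);
  sys_act_comp : forall u v w (g : arrow v w) (h : arrow u v) x,
    os_set (sys_fib u) x -> sys_act g (sys_act h x) = sys_act (gcomp g h) x
}.

Section Systems.
Variables (R : realType) (G : groupoid).
Implicit Types A B C W : gsystem R G.

Definition sys_map A B := forall u, os_alg (A u) -> os_alg (B u).

Definition sys_morphism A B (phi : sys_map A B) : Prop :=
  (forall u, ucp (A u) (B u) (@phi u)) /\
  (forall u v (g : arrow u v) x, os_set (A u) x ->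
     sys_act g (phi u x) = phi v (sys_act g x)).

Definition sys_injection A B (phi : sys_map A B) : Prop :=
  sys_morphism phi /\
  forall u, complete_order_injection (A u) (B u) (@phi u).

Definition sys_injective W : Prop :=
  forall B C (Phi : sys_map B C) (Psi : sys_map B W),
    sys_injection Phi -> sys_morphism Psi ->
    exists2 Theta : sys_map C W, sys_morphism Theta &
      forall u x, os_set (B u) x -> Theta u (Phi u x) = Psi u x.

Definition sys_rigid A W (Theta : sys_map A W) : Prop :=
  forall Phi : sys_map W W, sys_morphism Phi ->
    (forall u x, os_set (A u) x -> Phi u (Theta u x) = Theta u x) ->
    forall u y, os_set (W u) y -> Phi u y = y.

Definition injective_envelope A W : Prop :=
  sys_injective W /\
  exists2 Theta : sys_map A W, sys_injection Theta & sys_rigid Theta.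

Lemma trivial_act_iso (u v : G) (g : arrow u v) :
  complete_order_iso (full_opsys R[i]) (full_opsys R[i]) id.
Proof. by split; [|exists id => //]; exact: star_hom_ucp. Qed.

Definition trivial_system : gsystem R G :=
  @GSystem R G (fun _ => full_opsys R[i]) (fun _ _ _ => id)
    trivial_act_iso (fun _ _ _ _ _ _ _ => erefl).

End Systems.

Definition homeomorphism (X Y : topologicalType) (f : X -> Y) : Prop :=
  continuous f /\
  exists2 f' : Y -> X, continuous f' & cancel f f' /\ cancel f' f.

Record gspace (G : groupoid) := GSpace {
  sp_fib :> G -> compHausType;
  sp_act : forall u v, arrow u v -> sp_fib u -> sp_fib v;
  sp_act_homeo : forall u v (g : arrow u v), homeomorphism (sp_act g);
  sp_act1 : forall u x, sp_act (gunit u) x = x;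
  sp_actM : forall u v w (g : arrow v w) (h : arrow u v) x,
    sp_act g (sp_act h x) = sp_act (gcomp g h) x
}.

Section CX.
Variables (R : realType) (G : groupoid) (X : gspace G).

Lemma sp_act_cont u v (g : arrow u v) : continuous (@sp_act G X u v g).
Proof. by have [] := sp_act_homeo X g. Qed.

Lemma C_act_cont u v (g : arrow u v) (f : Cfun R (X u)) :
  continuous (fun x : X v => f (sp_act (ginv g) x)).
Proof.
move=> x; apply: (@continuous_comp _ _ _ (sp_act (ginv g)) f).
  exact: sp_act_cont.
exact: Cfun_continuous.
Qed.

Definition C_act u v (g : arrow u v) (f : Cfun R (X u)) : Cfun R (X v) :=
  MkCfun (@C_act_cont u v g f).

Lemma C_act_ucp u v (g : arrow u v) :
  ucp (full_opsys (Cfun R (X u))) (full_opsys (Cfun R (X v))) (C_act g).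
Proof.
apply: star_hom_ucp => [f1 f2|c f||f1 f2|f]; exact: CfunP.
Qed.

Lemma C_act_iso u v (g : arrow u v) : complete_order_iso
  (full_opsys (Cfun R (X u))) (full_opsys (Cfun R (X v))) (C_act g).
Proof.
split; first exact: C_act_ucp.
exists (C_act (ginv g)); first exact: C_act_ucp.
by split=> f _; apply: CfunP => x /=;
  rewrite sp_actM ?ginvK ?gcompVl ?gcompVr sp_act1.
Qed.

Lemma C_actM u v w (g : arrow v w) (h : arrow u v) (f : Cfun R (X u)) :
  os_set (full_opsys (Cfun R (X u))) f ->
  C_act g (C_act h f) = C_act (gcomp g h) f.
Proof. by move=> _; apply: CfunP => x /=; rewrite sp_actM ginvM. Qed.

Definition C_system : gsystem R G :=
  @GSystem R G (fun u => full_opsys (Cfun R (X u))) C_act C_act_iso C_actM.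

End CX.

Definition hamana_boundary (R : realType) (G : groupoid) (X : gspace G) :=
  injective_envelope (trivial_system R G) (C_system R X).

Definition borel (X : compHausType) := g_sigma_algebraType (@open X).

Record radon_prob (R : realType) (X : compHausType) := RadonProb {
  radon_val :> probability (borel X) R;
  radon_inner_regular : forall E : set (borel X), measurable E ->
    radon_val E =
      ereal_sup [set radon_val K | K in [set K : set X | compact K /\ K `<=` E]]
}.

HB.instance Definition _ (R : realType) (X : compHausType) :=
  gen_eqMixin (radon_prob R X).
HB.instance Definition _ (R : realType) (X : compHausType) :=
  gen_choiceMixin (radon_prob R X).

(* The weak* topology is the coarsest one making mu |-> \int f dmu continuous for
   every continuous f; real-valued f suffice. *)
Definition radon_pairing (R : realType) (X : compHausType)
    (mu : radon_prob R X) : {ptws continuousType X R -> R} :=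
  fun f => \int[mu]_x f x.

HB.instance Definition _ (R : realType) (X : compHausType) :=
  Topological.copy (radon_prob R X) (initial_topology (@radon_pairing R X)).

Section Radon.
Variables (R : realType).
Implicit Types X Y : compHausType.

Lemma borel_compact X (K : set X) :
  compact K -> measurable (K : set (borel X)).
Proof.
move=> cK; rewrite -[K]setCK; apply: measurableC; apply: sub_sigma_algebra.
by rewrite openC; apply: compact_closed => //; exact: hausdorffT.
Qed.

Lemma dirac_regular X (x : X) (E : set (borel X)) : measurable E ->
  (dirac (x : borel X) E : \bar R) =
    ereal_sup [set dirac (x : borel X) K | K in
      [set K : set X | compact K /\ K `<=` E]].
Proof.
move=> mE; apply/eqP; rewrite eq_le; apply/andP; split.
  have [xE|xE] := pselect (E x); last first.
    rewrite diracE memNset //; apply: ereal_sup_ubound; exists set0.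
      by split => //; exact: compact0.
    by rewrite diracE memNset.
  apply: ereal_sup_ubound; exists [set x].
    by split; [exact: compact_set1|move=> _ ->].
  by rewrite !diracE !mem_set.
apply: ge_ereal_sup => _ [K [cK KE] <-].
by apply: le_measure => //; rewrite inE //; exact: borel_compact.
Qed.

Definition point_mass X (x : X) : radon_prob R X :=
  RadonProb (radon_val := dirac (x : borel X)) (@dirac_regular X x).

Definition borel_map X Y (f : X -> Y) (cf : continuous f) :
  borel X -> borel Y := f.

Lemma borel_map_measurable X Y (f : X -> Y) (cf : continuous f) :
  measurable_fun [set: borel X] (borel_map cf).
Proof.
apply: (@measurability _ _ (borel X) (borel Y) _ _ (@open Y) erefl).
move=> _ [U oU <-]; rewrite setTI; apply: sub_sigma_algebra.
by apply: open_comp => // x _; exact: cf.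
Qed.

HB.instance Definition _ X Y (f : X -> Y) (cf : continuous f) :=
  isMeasurableFun.Build _ _ _ _ (borel_map cf) (borel_map_measurable cf).

Lemma push_regular X Y (f : X -> Y) (cf : continuous f) (mu : radon_prob R X)
    (E : set (borel Y)) : measurable E ->
  distribution mu (borel_map cf) E =
    ereal_sup [set distribution mu (borel_map cf) K | K in
      [set K : set Y | compact K /\ K `<=` E]].
Proof.
move=> mE.
have mf (A : set (borel Y)) : measurable A ->
    measurable (f @^-1` A : set (borel X)).
  by move=> mA; rewrite -[X in measurable X]setTI; exact: borel_map_measurable.
apply/eqP; rewrite eq_le; apply/andP; split; last first.
  apply: ge_ereal_sup => _ [K [cK KE] <-].
  by apply: le_measure => //; rewrite inE //; exact: borel_compact.
rewrite /distribution /pushforward (radon_inner_regular mu (mf _ mE)).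
apply: ge_ereal_sup => _ [K [cK KE] <-].
have cfK : compact (f @` K).
  by apply: continuous_compact => //; exact: continuous_subspaceT.
apply: (@le_trans _ _ (mu (f @^-1` (f @` K)))).
  apply: le_measure; rewrite ?inE; [exact: borel_compact| |].
    by apply: mf; exact: borel_compact.
  exact: preimage_image.
apply: ereal_sup_ubound; exists (f @` K) => //.
by split => // _ [x Kx <-]; exact: KE.
Qed.

Definition radon_push X Y (f : X -> Y) (cf : continuous f)
    (mu : radon_prob R X) : radon_prob R Y :=
  RadonProb (radon_val := distribution mu (borel_map cf)) (push_regular cf mu).

End Radon.

Section Boundaries.
Variable G : groupoid.
Implicit Types X Y : gspace G.

Definition gsubspace X (Y : forall u, set (X u)) : Prop :=
  (forall u, compact (Y u) /\ Y u !=set0) /\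
  (forall u v (g : arrow u v), sp_act g @` Y u = Y v).

Definition gminimal X : Prop :=
  forall Y : forall u, set (X u), gsubspace Y -> forall u, Y u = setT.

(* (g . mu)(E) is mu of the preimage of E under x |-> g . x, which is
   g^-1 . E. *)
Definition radon_act (R : realType) X u v (g : arrow u v) :
    radon_prob R (X u) -> radon_prob R (X v) :=
  radon_push (@sp_act_cont G X u v g).

Definition strongly_proximal (R : realType) X : Prop :=
  forall u v (mu : radon_prob R (X u)), [set: arrow u v] !=set0 ->
    closure (range (fun g : arrow u v => radon_act g mu)) `&`
      range (@point_mass R (X v)) !=set0.

Definition gboundary (R : realType) X : Prop :=
  gminimal X /\ strongly_proximal R X.

Definition gmap X Y (phi : forall u, X u -> Y u) : Prop :=
  (forall u, continuous (phi u)) /\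
  (forall u v (g : arrow u v) x, sp_act g (phi u x) = phi v (sp_act g x)).

Definition gisomorphic X Y : Prop :=
  exists2 phi : forall u, X u -> Y u,
    gmap phi & forall u, homeomorphism (phi u).

Definition furstenberg_boundary (R : realType) X : Prop :=
  gboundary R X /\
  forall Y, gboundary R Y ->
    exists2 phi : forall u, X u -> Y u,
      gmap phi & forall u (y : Y u), exists x, phi u x = y.

End Boundaries.

(* Main.v *)
(* Two applications of rigidity.  The bounded functions on a G-invariant family
   of sets Y_u of states of C(dH_u) form a G-system containing the trivial one,
   so the map sending f to the function S |-> S(f) on Y has a left inverse:
   G-injectivity extends C -> C(dH) to a G-morphism, and the composite fixes C,
   hence is the identity.  Thus a function that is nonnegative on all of Y_u is
   nonnegative.  For Y a G-subspace of point evaluations this gives minimality of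
   dH; for Y the orbit of a measure it shows that orbits charge small
   neighbourhoods of points fully, i.e. strong proximality.  So dF maps to dH by
   some phi.  In the same way phi^* : C(dH) -> C(dF) has a left inverse Theta.
   By the Riesz representation theorem and strong proximality of dF, some state
   f |-> Theta f y is a point evaluation, and by minimality of dH all of them
   are; this defines a section psi of phi, whose image is a G-subspace of the
   minimal space dF, so phi and psi are mutually inverse. *)

From HB Require Import structures.
Require Import Defs.
From mathcomp Require Import all_boot all_order all_algebra.
From mathcomp Require Import all_classical all_reals all_analysis.
From mathcomp Require Import measurable_realfun complex ring lra.

Set Implicit Arguments.
Unset Strict Implicit.
Unset Printing Implicit Defensive.

Import Order.TTheory GRing.Theory Num.Theory numFieldNormedType.Exports.

Local Open Scope classical_set_scope.
Local Open Scope ring_scope.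

(** * Continuous functions on compact Hausdorff spaces *)

Section RealContinuous.
Variables (R : realType) (T : topologicalType).
Implicit Types f g : T -> R.

Lemma contD f g : continuous f -> continuous g ->
  continuous (fun x => f x + g x).
Proof. by move=> cf cg x; apply: cvgD; [exact: cf|exact: cg]. Qed.

Lemma contB f g : continuous f -> continuous g ->
  continuous (fun x => f x - g x).
Proof. by move=> cf cg x; apply: cvgB; [exact: cf|exact: cg]. Qed.

Lemma contM f g : continuous f -> continuous g ->
  continuous (fun x => f x * g x).
Proof. by move=> cf cg x; apply: cvgM; [exact: cf|exact: cg]. Qed.

Lemma cont_cst (c : R) : continuous (fun _ : T => c).
Proof. by move=> x; exact: cvg_cst. Qed.

Lemma contZ (c : R) f : continuous f -> continuous (fun x => c * f x).
Proof. by move=> cf; apply: contM => //; exact: cont_cst. Qed.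

Lemma cont_min f g : continuous f -> continuous g ->
  continuous (fun x => Num.min (f x) (g x)).
Proof.
by move=> cf cg x; apply: (@continuous_min R T f g); [exact: cf|exact: cg].
Qed.

Lemma cont_max f g : continuous f -> continuous g ->
  continuous (fun x => Num.max (f x) (g x)).
Proof.
by move=> cf cg x; apply: (@continuous_max R T f g); [exact: cf|exact: cg].
Qed.

Lemma cont_ge_closed f (c : R) : continuous f -> closed [set x | c <= f x].
Proof.
move=> cf; apply: (@closed_comp _ _ f [set y | c <= y]) => [x _|].
  exact: cf.
exact: closed_ge.
Qed.

Lemma cont_gt_open f (c : R) : continuous f -> open [set x | c < f x].
Proof.
move=> cf; apply: (@open_comp _ _ f [set y | c < y]) => [x _|].
  exact: cf.
exact: open_gt.
Qed.

End RealContinuous.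

Section CompactHausdorff.
Variables (R : realType) (X : compHausType).

Lemma closed_compactT (A : set X) : closed A -> compact A.
Proof. by move=> cA; apply: subclosed_compact cA (@compactT X) _. Qed.

Lemma compHaus_urysohn (A B : set X) : closed A -> closed B ->
  (forall x, A x -> B x -> False) ->
  exists f : X -> R, [/\ continuous f, forall x, 0 <= f x <= 1,
    forall x, A x -> f x = 0 & forall x, B x -> f x = 1].
Proof.
move=> cA cB AB; have nX : normal_space X.
  by apply: compact_normal; [exact: hausdorffT|exact: compactT].
have AB0 : A `&` B = set0 by rewrite -subset0 => x [Ax Bx]; exact: AB Ax Bx.
have [f [cf f01 fA fB]] :=
  (@uniform_separatorP _ R A B).1 ((@normal_separatorP R X).1 nX A B cA cB AB0).
exists f; split => // [x|x Ax|x Bx].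
- by have := f01 (f x); rewrite /= in_itv /=; apply; exists x.
- by apply: fA; exists x.
- by apply: fB; exists x.
Qed.

Lemma urysohn_point (x : X) (U : set X) : open U -> U x ->
  exists f : X -> R, [/\ continuous f, forall y, 0 <= f y <= 1,
    forall y, ~ U y -> f y = 0 & f x = 1].
Proof.
move=> oU Ux; have cx : closed [set x].
  by apply: accessible_closed_set1; apply: hausdorff_accessible; exact: hausdorffT.
have [|f [cf f01 f0 f1]] := @compHaus_urysohn (~` U) [set x] (open_closedC oU) cx.
  by move=> y nUy /= yx; apply: nUy; rewrite yx.
by exists f; split => //; exact: f1.
Qed.

(** The bound is made strictly positive so that later rescalings can divide by it. *)
Lemma cont_bounded (f : X -> R) : continuous f ->
  exists2 M : R, 0 < M & forall x, `|f x| <= M.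
Proof.
move=> cf; have cnf : {within [set: X], continuous (fun x => `|f x|)}.
  by apply: continuous_subspaceT => x; apply: cvg_norm; exact: cf.
have [x0 _ xM] := compact_EVT_max (ex_intro _ point I) (@compactT X) cnf.
exists (`|f x0| + 1); first by rewrite ltr_pwDr.
by move=> x; apply: (le_trans (xM x (mem_set I))); rewrite lerDl.
Qed.

End CompactHausdorff.

(** * The Riesz representation theorem *)

Section RadonIntegral.
Variables (R : realType) (X : compHausType) (mu : radon_prob R X).
Implicit Types f g : X -> R.

Lemma cont_measurable f : continuous f ->
  measurable_fun [set: borel X] (f : borel X -> R).
Proof.
move=> /continuousP cf; apply: (measurability _ (RGenOpens.measurableE R)).
move=> _ [_ [a [b ->] <-]]; rewrite setTI; apply: sub_sigma_algebra.
exact/cf/interval_open.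
Qed.

Lemma cont_integrable f : continuous f ->
  mu.-integrable [set: borel X] (EFin \o (f : borel X -> R)).
Proof.
move=> cf; apply: measurable_bounded_integrable => //.
- by apply: (@le_lt_trans _ _ 1%E); [exact: (probability_le1 mu)|exact: ltry].
- exact: cont_measurable.
- have [M M0 fM] := cont_bounded cf.
  exists M; split; first exact: num_real.
  by move=> y My x _; exact: le_trans (fM x) (ltW My).
Qed.

Definition rint f : R := \int[mu]_x f x.

Lemma rintD f g : continuous f -> continuous g ->
  rint (fun x => f x + g x) = rint f + rint g.
Proof. by move=> cf cg; rewrite /rint RintegralD //; exact: cont_integrable. Qed.

Lemma rintZ (c : R) f : continuous f -> rint (fun x => c * f x) = c * rint f.
Proof. by move=> cf; rewrite /rint RintegralZl //; exact: cont_integrable. Qed.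

Lemma rint_ge0 f : (forall x, 0 <= f x) -> 0 <= rint f.
Proof. by move=> f0; apply: Rintegral_ge0 => x _. Qed.

Lemma rint1 : rint (fun=> 1) = 1.
Proof.
by rewrite /rint Rintegral_cst // mul1r -[RHS]/(fine 1); congr fine; exact: (probability_setT mu).
Qed.

Lemma rint_indic_le (U : set X) f : open U -> continuous f ->
  (forall x, 0 <= f x) -> (forall x, U x -> 1 <= f x) -> fine (mu U) <= rint f.
Proof.
move=> oU cf f0 f1; have mU : measurable (U : set (borel X)).
  exact: sub_sigma_algebra.
have -> : fine (mu U) = \int[mu]_x (\1_(U : set (borel X)) x).
  by rewrite /Rintegral integral_indic // setIT.
apply: le_Rintegral => //.
- exact: integrable_indic.
- exact: cont_integrable.
- move=> x _; rewrite indicE; case: (boolP (x \in _)) => [|_]; last exact: f0.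
  by rewrite in_setE => /f1.
Qed.

End RadonIntegral.

Section Riesz.
Variables (R : realType) (X : compHausType) (L : (X -> R) -> R).
Hypothesis LD : forall f g : X -> R, continuous f -> continuous g ->
  L (fun x => f x + g x) = L f + L g.
Hypothesis LZ : forall (c : R) (f : X -> R), continuous f -> L (fun x => c * f x) = c * L f.
Hypothesis L_ge0 : forall f : X -> R, continuous f -> (forall x, 0 <= f x) -> 0 <= L f.
Hypothesis L1 : L (fun=> 1) = 1.

Let LB (f g : X -> R) : continuous f -> continuous g -> L (fun x => f x - g x) = L f - L g.
Proof.
move=> cf cg; rewrite -[in RHS]mulN1r -LZ // -LD //; last exact: contZ.
by congr L; apply/funext => x; rewrite mulN1r.
Qed.

Let Lle (f g : X -> R) : continuous f -> continuous g -> (forall x, f x <= g x) ->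
  L f <= L g.
Proof.
move=> cf cg fg; rewrite -subr_ge0 -LB //; apply: L_ge0; first exact: contB.
by move=> x; rewrite subr_ge0.
Qed.

Let Lcst (c : R) : L (fun=> c) = c.
Proof.
rewrite -[RHS]mulr1 -[in RHS]L1 -LZ; last exact: cont_cst.
by congr L; apply/funext => x; rewrite mulr1.
Qed.

(** Vanishing off [U] replaces the usual compact support inside [U]; truncation by [cut] recovers
    compactness when it is needed. *)
Definition below (U : set X) (f : X -> R) : Prop :=
  [/\ continuous f, forall x, 0 <= f x <= 1 & forall x, ~ U x -> f x = 0].

(** For open [U] this is the mass that the representing measure will give to [U]. *)
Definition rho (U : set X) : R := sup [set L f | f in below U].

Lemma below0 U : below U (fun=> 0).
Proof. by split => //; [exact: cont_cst|move=> x; rewrite lexx ler01]. Qed.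

Lemma below_le1 U f : below U f -> L f <= 1.
Proof.
move=> [cf f01 _]; rewrite -L1; apply: Lle => //; first exact: cont_cst.
by move=> x; case/andP: (f01 x).
Qed.

Lemma has_sup_rho U : has_sup [set L f | f in below U].
Proof.
split; first by exists (L (fun=> 0)), (fun=> 0) => //; exact: below0.
by exists 1 => _ [f /below_le1 f1 <-].
Qed.

Lemma rho_ub U f : below U f -> L f <= rho U.
Proof. by move=> Uf; apply: sup_upper_bound; [exact: has_sup_rho|exists f]. Qed.

Lemma rho_le U c : (forall f, below U f -> L f <= c) -> rho U <= c.
Proof.
move=> h; apply: ge_sup; first by case: (has_sup_rho U).
by move=> _ [f /h ? <-].
Qed.

Lemma rho_adherent U e : 0 < e -> exists2 f, below U f & rho U - e < L f.
Proof.
by move=> e0; have [_ [f Uf <-] h] := sup_adherent e0 (has_sup_rho U); exists f.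
Qed.

Lemma rho_ge0 U : 0 <= rho U.
Proof. by rewrite -(Lcst 0); apply: rho_ub; exact: below0. Qed.

Lemma rho_homo U V : U `<=` V -> rho U <= rho V.
Proof.
move=> UV; apply: rho_le => f [cf f01 f0]; apply: rho_ub; split => //.
by move=> x nV; apply: f0 => /UV.
Qed.

Lemma rho0 : rho set0 = 0.
Proof.
apply/eqP; rewrite eq_le rho_ge0 andbT; apply: rho_le => f [cf _ f0].
rewrite (_ : f = fun=> 0) ?Lcst //; apply/funext => x; exact: f0.
Qed.

Lemma rhoT : rho setT = 1.
Proof.
apply/eqP; rewrite eq_le; apply/andP; split.
  by apply: rho_le => f; exact: below_le1.
rewrite -[leLHS]L1; apply: rho_ub; split; first exact: cont_cst.
  by move=> x; rewrite ler01 lexx.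
by move=> x /(_ I).
Qed.

(* Cutting f down by e makes its support compact inside the open set off which
   f vanishes, at the cost of at most e for L. *)
Let cut (e : R) (f : X -> R) := fun x => Num.max (f x - e) 0.

Let cut_cont e f : continuous f -> continuous (cut e f).
Proof.
move=> cf; apply: cont_max; last exact: cont_cst.
by apply: contB => //; exact: cont_cst.
Qed.

Let Lcut e f : continuous f -> L f <= L (cut e f) + e.
Proof.
move=> cf; rewrite -lerBlDr -[X in _ - X]Lcst -LB //; last exact: cont_cst.
apply: Lle; [by apply: contB => //; exact: cont_cst|exact: cut_cont|].
by move=> x; rewrite /cut le_max lexx.
Qed.

Let cut01 e f x : 0 <= e -> 0 <= f x <= 1 -> 0 <= cut e f x <= 1.
Proof.
move=> e0 /andP[f0 f1]; rewrite /cut le_max lexx orbT /= ge_max ler01 andbT.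
by rewrite lerBlDr (le_trans f1) // lerDl.
Qed.

Let cut_eq0 e f x : f x <= e -> cut e f x = 0.
Proof. by move=> fe; apply/max_idPr; rewrite subr_le0. Qed.

(** A Urysohn function [g], equal to 0 off [U] and to 1 on the part of [e <= f] outside [V], splits
    [cut e f] into [cut e f * g], which is below [U], and [cut e f * (1 - g)], which is below
    [V]. *)
Lemma rhoU U V : open U -> open V -> rho (U `|` V) <= rho U + rho V.
Proof.
move=> oU oV; apply: rho_le => f [cf f01 f0]; apply/ler_addgt0Pr => e e0.
pose A := [set x | e <= f x] `&` ~` V.
have cA : closed A by apply: closedI; [exact: cont_ge_closed|exact: open_closedC].
have [|g [cg g01 g0 g1]] := @compHaus_urysohn R X (~` U) A (open_closedC oU) cA.
  move=> x nU [/= ef nV]; have : f x = 0 by apply: f0 => -[].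
  by move=> fx; move: ef; rewrite fx leNgt e0.
have cc := @cut_cont e f cf.
have c1g : continuous (fun x => 1 - g x) by apply: contB => //; exact: cont_cst.
apply: (le_trans (@Lcut e f cf)); rewrite lerD2r.
have -> : L (cut e f) = L (fun x => cut e f x * g x) +
    L (fun x => cut e f x * (1 - g x)).
  rewrite -LD; [|exact: contM|exact: contM].
  by congr L; apply/funext => x; rewrite -mulrDr addrC subrK mulr1.
have ce x := cut01 (ltW e0) (f01 x).
apply: lerD; apply: rho_ub; split.
- exact: contM.
- move=> x; case/andP: (ce x) => c0 c1; case/andP: (g01 x) => g0' g1'.
  by rewrite mulr_ge0 //= mulr_ile1.
- by move=> x nU; rewrite g0 // mulr0.
- exact: contM.
- move=> x; case/andP: (ce x) => c0 c1; case/andP: (g01 x) => g0' g1'.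
  by rewrite mulr_ge0 ?subr_ge0 //= mulr_ile1 ?subr_ge0 // lerBlDr lerDl.
- move=> x nV; have [fe|fe] := leP (f x) e; first by rewrite cut_eq0 // mul0r.
  by rewrite g1 ?subrr ?mulr0 //; split => //=; exact: ltW.
Qed.

Lemma rho_bigU (U : nat -> set X) n : (forall i, open (U i)) ->
  rho (\big[setU/set0]_(i < n) U i) <= \sum_(i < n) rho (U i).
Proof.
move=> oU; elim: n => [|n IH]; first by rewrite !big_ord0 rho0.
rewrite !big_ord_recr /=; apply: (le_trans (rhoU _ (oU _))).
  by rewrite -bigcup_mkord; apply: bigcup_open.
by rewrite lerD2r.
Qed.

(** The set [e <= f] is compact and covered by the [U i], so [cut e f] already vanishes off a finite
    union of them. *)
Lemma rho_bigcup (U : nat -> set X) f e : (forall i, open (U i)) -> 0 < e ->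
  below (\bigcup_i U i) f -> exists n, L f <= \sum_(i < n) rho (U i) + e.
Proof.
move=> oU e0 [cf f01 f0].
have cK : compact [set x | e <= f x].
  by apply: closed_compactT; exact: cont_ge_closed.
move: cK; rewrite compact_cover => /(_ nat [set: nat] U (fun i _ => oU i)) [|D _ DK].
  move=> x /= ef; apply: contrapT => nU; move: ef.
  by rewrite f0 // leNgt e0.
(* One more than the largest index of the finite subcover, because the sum runs over [i < n]. *)
exists (\max_(i <- finmap.enum_fset D) i).+1.
apply: (le_trans (@Lcut e f cf)); rewrite lerD2r.
apply: le_trans (rho_bigU _ oU); apply: rho_ub; split.
- exact: cut_cont.
- by move=> x; apply: cut01; [exact: ltW|].
- move=> x nU; apply: cut_eq0; rewrite leNgt; apply/negP => ef; apply: nU.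
  have [i /= Di Ui] := DK x (ltW ef).
  rewrite -bigcup_mkord; exists i => //=; rewrite ltnS.
  by rewrite (@leq_bigmax_seq _ _ _ id).
Qed.

Definition omu (E : set X) : R := inf [set rho U | U in [set U | open U /\ E `<=` U]].

Let has_inf_omu E : has_inf [set rho U | U in [set U | open U /\ E `<=` U]].
Proof.
split; first by exists (rho setT), setT => //; split => //; exact: openT.
by exists 0 => _ [U _ <-]; exact: rho_ge0.
Qed.

Lemma omu_le_rho E U : open U -> E `<=` U -> omu E <= rho U.
Proof.
by move=> oU EU; apply: inf_lbound; [case: (has_inf_omu E)|exists U].
Qed.

Lemma omu_adherent E e : 0 < e ->
  exists U, [/\ open U, E `<=` U & rho U < omu E + e].
Proof.
by move=> e0; have [_ [U [oU EU] <-] h] := inf_adherent e0 (has_inf_omu E); exists U.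
Qed.

Lemma le_omu E c : (forall U, open U -> E `<=` U -> c <= rho U) -> c <= omu E.
Proof.
move=> h; apply: lb_le_inf; first by case: (has_inf_omu E).
by move=> _ [U [oU EU] <-]; exact: h.
Qed.

Lemma omu_open U : open U -> omu U = rho U.
Proof.
move=> oU; apply/eqP; rewrite eq_le omu_le_rho //=; apply: le_omu => V _.
exact: rho_homo.
Qed.

(** * The Riesz outer measure and its Carathéodory-measurable sets *)

Definition riesz_outer (E : set X) : \bar R := (omu E)%:E.

Lemma riesz_outer0 : riesz_outer set0 = 0%E.
Proof. by rewrite /riesz_outer omu_open ?rho0 //; exact: open0. Qed.

Lemma riesz_outer_ge0 E : (0 <= riesz_outer E)%E.
Proof. by rewrite lee_fin; apply: le_omu => U _ _; exact: rho_ge0. Qed.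

Lemma le_riesz_outer : {homo riesz_outer : A B / A `<=` B >-> (A <= B)%E}.
Proof.
move=> A B AB; rewrite lee_fin; apply: le_omu => U oU BU.
by apply: omu_le_rho => //; exact: subset_trans BU.
Qed.

(** Each [F n] is covered by an open [U n] of excess below [e / 2 / 2 ^ n.+1]. Half of [e] pays for
    these excesses, the other half for passing to finitely many [U i] through [rho_bigcup]. *)
Lemma riesz_outer_sigma_subadditive : sigma_subadditive riesz_outer.
Proof.
move=> F; apply/lee_addgt0Pr => e e0.
have e20 : 0 < e / 2 by rewrite divr_gt0.
have /choice[U hU] (n : nat) : exists U, [/\ open U, F n `<=` U &
    rho U < omu (F n) + e / 2 / (2 ^ n.+1)%:R].
  by apply: omu_adherent; rewrite divr_gt0 // ltr0n expn_gt0.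
have oU n : open (U n) by case: (hU n).
apply: (@le_trans _ _ (rho (\bigcup_n U n))%:E).
  rewrite lee_fin; apply: omu_le_rho; first exact: bigcup_open.
  by apply: subset_bigcup => n _; case: (hU n).
have key : (\sum_(n <oo) ((riesz_outer (F n)) + (e / 2 / (2 ^ n.+1)%:R)%:E) <=
    \sum_(n <oo) riesz_outer (F n) + (e / 2)%:E)%E.
  apply: epsilon_trick => [n|]; first exact: riesz_outer_ge0.
  exact: ltW.
rewrite (splitr e) EFinD addeA; apply: le_trans (leeD2r _ key).
have [t|] := boolP ((\sum_(n <oo) ((riesz_outer (F n)) +
    (e / 2 / (2 ^ n.+1)%:R)%:E))%E \is a fin_num).
  rewrite -(fineK t) -EFinD lee_fin; apply: rho_le => f Uf.
  have [n hn] := rho_bigcup oU e20 Uf; apply: (le_trans hn); rewrite lerD2r.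
  rewrite -lee_fin fineK // -sumEFin.
  apply: (@le_trans _ _ (\sum_(i < n) (riesz_outer (F i) +
      (e / 2 / (2 ^ i.+1)%:R)%:E))%E).
    apply: lee_sum => i _; rewrite /riesz_outer -EFinD lee_fin.
    by apply: ltW; case: (hU i).
  rewrite -(big_mkord xpredT (fun i => (riesz_outer (F i) +
      (e / 2 / (2 ^ i.+1)%:R)%:E)%E)).
  apply: nneseries_lim_ge => i _ _; rewrite adde_ge0 ?riesz_outer_ge0 //.
  by rewrite lee_fin divr_ge0 // ltW.
(* The terms are nonnegative, so a series that is not finite equals [+oo] and the bound is
   trivial. *)
rewrite ge0_fin_numE; last first.
  apply: nneseries_ge0 => i _ _; rewrite adde_ge0 ?riesz_outer_ge0 //.
  by rewrite lee_fin divr_ge0 // ltW.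
by rewrite -leNgt leye_eq => /eqP ->; rewrite addye // leey.
Qed.

HB.instance Definition _ := isOuterMeasure.Build R X riesz_outer riesz_outer0
  riesz_outer_ge0 le_riesz_outer riesz_outer_sigma_subadditive.

(** The test set is first enlarged to an open [V]. Let [f] be nearly optimal below [V] intersected
    with [U]. The rest of [V] lies in the open set [W] where [f < e / 2], and there [cut (e / 2) f]
    vanishes; hence adding to it any [g] below [W] gives a function that is still below [V]. *)
Lemma open_caratheodory (U : set X) : open U -> riesz_outer.-caratheodory U.
Proof.
move=> oU; apply: (@le_caratheodory_measurable R X riesz_outer) => E.
rewrite /riesz_outer -EFinD lee_fin; apply: le_omu => V oV EV.
apply: (@le_trans _ _ (rho (V `&` U) + omu (V `&` ~` U))).
  apply: lerD; last by rewrite -lee_fin; apply: le_riesz_outer; exact: setSI.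
  by apply: omu_le_rho; [exact: openI|exact: setSI].
apply/ler_addgt0Pr => e e0; have e20 : 0 < e / 2 by rewrite divr_gt0.
have [f [cf f01 f0] hf] := rho_adherent (V `&` U) e20.
pose W := V `&` [set x | f x < e / 2].
have oW : open W.
  apply: openI => //; apply: (@open_comp _ _ f [set y | y < e / 2]) => [x _|].
    exact: cf.
  exact: open_lt.
have VW : omu (V `&` ~` U) <= rho W.
  apply: omu_le_rho => // x [Vx nU]; split => //=.
  by rewrite f0 // => -[].
have {}VW : rho (V `&` U) + omu (V `&` ~` U) <= L f + e / 2 + rho W.
  by apply: lerD => //; rewrite -lerBlDr ltW.
apply: (le_trans VW).
rewrite -lerBrDl; apply: rho_le => g [cg g01 g0].
rewrite lerBrDl (le_trans (_ : _ <= L (fun x => cut (e / 2) f x + g x) + e)) //.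
  rewrite LD //; last exact: cut_cont.
  have := @Lcut (e / 2) f cf; lra.
rewrite lerD2r; apply: rho_ub; split.
- by apply: contD => //; exact: cut_cont.
- move=> x; have [fe|fe] := leP (f x) (e / 2).
    by rewrite cut_eq0 // add0r.
  by rewrite g0 ?addr0 => [|[_ /=]]; [apply: cut01 => //; exact: ltW|rewrite ltNge (ltW fe)].
- move=> x nV; rewrite g0; last by case.
  by rewrite cut_eq0 ?addr0 // f0 ?ltW // => -[].
Qed.

Lemma borel_caratheodory (E : set (borel X)) :
  measurable E -> riesz_outer.-caratheodory E.
Proof.
suff h : <<s @open X >> `<=` riesz_outer.-caratheodory by exact: h.
apply: smallest_sub; last exact: open_caratheodory.
split.
- exact: (caratheodory_measurable_set0 riesz_outer).
- by move=> A mA; rewrite setTD; exact: (caratheodory_measurable_setC (mu := riesz_outer)).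
- exact: (caratheodory_measurable_bigcup (mu := riesz_outer)).
Qed.

Definition riesz_measure (E : set (borel X)) : \bar R := riesz_outer E.

Let riesz_measure_semi_sigma_additive : semi_sigma_additive riesz_measure.
Proof.
move=> F mF tF mUF.
by apply: (@caratheodory_measure_sigma_additive R X riesz_outer) => //;
  [move=> i; exact: borel_caratheodory|exact: borel_caratheodory].
Qed.

HB.instance Definition _ := isMeasure.Build _ (borel X) R riesz_measure
  riesz_outer0 riesz_outer_ge0 riesz_measure_semi_sigma_additive.

Let riesz_measureT : riesz_measure setT = 1%E.
Proof. by rewrite /riesz_measure /riesz_outer omu_open ?rhoT //; exact: openT. Qed.

HB.instance Definition _ :=
  Measure_isProbability.Build _ (borel X) R riesz_measure riesz_measureT.

(** Outer regularity of the complement: if an open [U] contains [~]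
    E[with excess less than]e[, then]~[U] is compact, lies in [E] and misses mass less than [e], the
    total mass being 1. *)
Lemma riesz_measure_regular (E : set (borel X)) : measurable E ->
  riesz_measure E =
    ereal_sup [set riesz_measure K | K in [set K : set X | compact K /\ K `<=` E]].
Proof.
move=> mE; apply/eqP; rewrite eq_le; apply/andP; split; last first.
  by apply: ge_ereal_sup => _ [K [cK KE] <-]; exact: le_riesz_outer.
apply/lee_addgt0Pr => e e0.
have [U [oU EU hU]] := omu_adherent (~` E) e0.
have mU : measurable (U : set (borel X)) by exact: sub_sigma_algebra.
apply: (@le_trans _ _ (riesz_measure (~` U) + e%:E)%E); last first.
  rewrite leeD2r //; apply: ereal_sup_ubound; exists (~` U) => //; split.
    by apply: closed_compactT; exact: open_closedC.
  exact: subsetCl.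
have hE := probability_setC (riesz_measure : probability (borel X) R) mE.
have hU' := probability_setC (riesz_measure : probability (borel X) R) mU.
move: hU; rewrite -(omu_open oU) => hU; rewrite hU'.
move: hE; rewrite /= /riesz_measure /riesz_outer -EFinB => -[] hE.
rewrite -EFinB -EFinD lee_fin; move: hU; rewrite hE; lra.
Qed.

Definition riesz_radon : radon_prob R X :=
  RadonProb (radon_val := riesz_measure) riesz_measure_regular.

(** * Comparison of [L] with integration against the Riesz measure *)

Let I := rint riesz_radon.

Let layer (f : X -> R) (N k : nat) := fun x =>
  Num.min (f x) (k.+1%:R / N%:R) - Num.min (f x) (k%:R / N%:R).

Let layer_cont f N k : continuous f -> continuous (layer f N k).
Proof. by move=> cf; apply: contB; apply: cont_min => //; exact: cont_cst. Qed.

Let layer_eq0 f N k x : f x <= k%:R / N%:R -> layer f N k x = 0.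
Proof.
move=> fk; rewrite /layer (min_idPl _) ?(min_idPl fk) ?subrr //.
apply: (le_trans fk); rewrite ler_wpM2r ?invr_ge0 ?ler0n //.
by rewrite ler_nat.
Qed.

Let layer_ge0 f N k x : 0 <= layer f N k x.
Proof.
rewrite subr_ge0 le_min !ge_min lexx /=; apply/orP; right.
by rewrite ler_wpM2r ?invr_ge0 ?ler0n // ler_nat.
Qed.

Let layer_eq f N k x : k.+1%:R / N%:R <= f x -> layer f N k x = N%:R^-1.
Proof.
move=> fk; have kk : k%:R / N%:R <= k.+1%:R / N%:R :> R.
  by rewrite ler_wpM2r ?invr_ge0 ?ler0n // ler_nat.
rewrite /layer (min_idPr fk) (min_idPr (le_trans kk fk)) -mulrBl.
by rewrite -natr1 addrAC subrr add0r mul1r.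
Qed.

Let layer_le f N k x : layer f N k x <= N%:R^-1.
Proof.
have [fk|fk] := leP (k.+1%:R / N%:R) (f x); first by rewrite layer_eq.
have [fk'|fk'] := leP (f x) (k%:R / N%:R).
  by rewrite layer_eq0 // invr_ge0 ler0n.
rewrite /layer (min_idPl (ltW fk)) (min_idPr (ltW fk')) lerBlDr (le_trans (ltW fk)) //.
by rewrite -[X in _ <= X + _]mul1r -mulrDl addrC natr1.
Qed.

(* Writing f as a sum of N layers of height 1/N, [N * layer k] lies between the
   indicators of [f > (k+1)/N] and [f > k/N]: comparing L of one layer with the
   integral of the previous one leaves an error of a single layer. *)
Lemma L_le_riesz01 (f : X -> R) : continuous f -> (forall x, 0 <= f x <= 1) -> L f <= I f.
Proof.
move=> cf f01; apply/ler_addgt0Pr => e e0.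
have [N hN] : exists N, N.+1%:R^-1 < e.
  by have [N _ hN] := near_infty_natSinv_lt (PosNum e0); exists N; exact: hN (leqnn N).
set n := N.+1 in hN.
have n0 : 0 < n%:R :> R by rewrite ltr0n.
pose U k := [set x | k%:R / n%:R < f x].
have oU k : open (U k) by exact: cont_gt_open.
have clay k := @layer_cont f n k cf.
have LU k : L (layer f n k) <= rho (U k) / n%:R.
  rewrite ler_pdivlMr // mulrC -LZ //; apply: rho_ub; split.
  - exact: contZ.
  - move=> x; rewrite mulr_ge0 ?layer_ge0 ?ler0n //=.
    by rewrite -ler_pdivlMl // mulr1 layer_le.
  - by move=> x /negP; rewrite -leNgt => /layer_eq0 ->; rewrite mulr0.
have UI k : rho (U k.+1) / n%:R <= I (layer f n k).
  rewrite ler_pdivrMr // mulrC /I -rintZ // -(omu_open (oU _)).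
  apply: (@rint_indic_le _ _ riesz_radon) => //.
  - exact: contZ.
  - by move=> x; rewrite mulr_ge0 ?layer_ge0 ?ler0n.
  - by move=> x /ltW /layer_eq ->; rewrite divff // gt_eqF.
pose m k := fun x => Num.min (f x) (k%:R / n%:R).
have cm k : continuous (m k) by apply: cont_min => //; exact: cont_cst.
have mS k : m k.+1 = (fun x => m k x + layer f n k x).
  by apply/funext => x; rewrite /m /layer addrC subrK.
have m0 : m 0%N = fun=> 0.
  apply/funext => x; rewrite /m mulr0n mul0r; apply/min_idPr.
  by case/andP: (f01 x).
have ineq k : L (m k.+1) <= n%:R^-1 + I (m k).
  elim: k => [|k IH].
    rewrite mS LD // m0 Lcst add0r (le_trans (LU 0)) //.
    rewrite ler_wpDr ?rint_ge0 // ler_piMl ?invr_ge0 ?ler0n //.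
    by apply: rho_le => g; exact: below_le1.
  rewrite mS LD // [in I _]mS /I rintD // addrA lerD //.
  exact: le_trans (LU _) (UI _).
have mf k : (n <= k)%N -> m k = f.
  move=> nk; apply/funext => x; apply/min_idPl.
  case/andP: (f01 x) => _ /le_trans; apply.
  by rewrite ler_pdivlMr // mul1r ler_nat.
(* Since [m k = f] for every [k >= n], the shifted inequality at [k = n] has [f] on both sides. *)
have := ineq n; rewrite (mf _ (leqnSn n)) (mf _ (leqnn n)).
by move=> /le_trans; apply; rewrite addrC lerD2l ltW.
Qed.

(** The rescaling [(M + g) / (2 * M)] takes values in [0, 1], which extends [L_le_riesz01] to all
    [g] bounded by [M]. The inequalities for [f] and for [-1 * f] together give equality. *)
Theorem riesz_representation (f : X -> R) : continuous f -> rint riesz_radon f = L f.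
Proof.
move=> cf; have [M M0 fM] := cont_bounded cf.
have key (g : X -> R) : continuous g -> (forall x, `|g x| <= M) -> L g <= I g.
  move=> cg gM; have M2 : 0 < 2 * M by rewrite mulr_gt0.
  have cs : continuous (fun x => M + g x) by apply: contD => //; exact: cont_cst.
  have : L (fun x => (2 * M)^-1 * (M + g x)) <= I (fun x => (2 * M)^-1 * (M + g x)).
    apply: L_le_riesz01; first exact: contZ.
    move=> x; have := gM x; rewrite ler_norml => /andP[h1 h2].
    rewrite mulr_ge0 ?invr_ge0 ?(ltW M2) //=; last by rewrite addrC -lerBlDr sub0r.
    by rewrite -ler_pdivlMl ?invr_gt0 // invrK mulr1 mulrDl mul1r lerD2l.
  rewrite /I LZ // rintZ // ler_pM2l ?invr_gt0 // LD //; last exact: cont_cst.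
  have -> : (fun x => M + g x) = (fun x => M * (fun=> 1) x + g x).
    by apply/funext => x; rewrite mulr1.
  rewrite rintD //; last by apply: contZ; exact: cont_cst.
  by rewrite rintZ ?rint1 ?mulr1 ?Lcst ?lerD2l //; exact: cont_cst.
apply/eqP; rewrite eq_le (key f cf fM) andbT -lerN2.
have /key : continuous (fun x => -1 * f x) by exact: contZ.
rewrite LZ // /I rintZ // !mulN1r; apply => x.
by rewrite mulN1r normrN.
Qed.

End Riesz.


(** * Bounded functions *)

(** The C*-algebra of all bounded functions on a bare set [T], without topology; [T] will be a set
    of states. *)
Record Bfun (R : realType) (T : Type) := MkBfun {
  Bfun_fun :> T -> R[i];
  Bfun_bounded : exists M : R[i], forall x, `|Bfun_fun x| <= M
}.

HB.instance Definition _ (R : realType) (T : Type) := gen_eqMixin (Bfun R T).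
HB.instance Definition _ (R : realType) (T : Type) := gen_choiceMixin (Bfun R T).

Section Bfun.
Variables (R : realType) (T : Type).
Implicit Types (f g h : Bfun R T) (c : R[i]).

Lemma BfunP f g : (forall x, f x = g x) -> f = g.
Proof.
case: f g => [f cf] [g cg] /= /funext fg; rewrite fg in cf *.
by congr MkBfun; exact: Prop_irrelevance.
Qed.

Lemma Badd_bounded f g : exists M : R[i], forall x, `|f x + g x| <= M.
Proof.
have [M fM] := Bfun_bounded f; have [N gN] := Bfun_bounded g.
exists (M + N) => x; apply: (le_trans (ler_normD _ _)).
by apply: lerD; [exact: fM|exact: gN].
Qed.
Lemma Bopp_bounded f : exists M : R[i], forall x, `|- f x| <= M.
Proof. by have [M fM] := Bfun_bounded f; exists M => x; rewrite normrN. Qed.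
Lemma Bmul_bounded f g : exists M : R[i], forall x, `|f x * g x| <= M.
Proof.
have [M fM] := Bfun_bounded f; have [N gN] := Bfun_bounded g.
by exists (M * N) => x; rewrite normrM ler_pM.
Qed.
Lemma Bcst_bounded c : exists M : R[i], forall _ : T, `|c| <= M.
Proof. by exists `|c|. Qed.
Lemma Bscale_bounded c f : exists M : R[i], forall x, `|c * f x| <= M.
Proof.
have [M fM] := Bfun_bounded f.
by exists (`|c| * M) => x; rewrite normrM ler_wpM2l.
Qed.
Lemma Bconj_bounded f : exists M : R[i], forall x, `|(f x)^*| <= M.
Proof. by have [M fM] := Bfun_bounded f; exists M => x; rewrite norm_conjC. Qed.

Definition Badd f g := MkBfun (Badd_bounded f g).
Definition Bopp f := MkBfun (Bopp_bounded f).
Definition Bcst c := MkBfun (Bcst_bounded c).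
Definition Bmul f g := MkBfun (Bmul_bounded f g).
Definition Bscale c f := MkBfun (Bscale_bounded c f).
Definition Bconj f := MkBfun (Bconj_bounded f).

Fact BaddA : associative Badd.
Proof. by move=> f g h; apply: BfunP => x; rewrite /= addrA. Qed.
Fact BaddC : commutative Badd.
Proof. by move=> f g; apply: BfunP => x; rewrite /= addrC. Qed.
Fact Badd0 : left_id (Bcst 0) Badd.
Proof. by move=> f; apply: BfunP => x; rewrite /= add0r. Qed.
Fact BaddN : left_inverse (Bcst 0) Bopp Badd.
Proof. by move=> f; apply: BfunP => x; rewrite /= addNr. Qed.

HB.instance Definition _ :=
  GRing.isZmodule.Build (Bfun R T) BaddA BaddC Badd0 BaddN.

Fact BscaleA c d f : Bscale c (Bscale d f) = Bscale (c * d) f.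
Proof. by apply: BfunP => x; rewrite /= mulrA. Qed.
Fact Bscale1 : left_id 1 Bscale.
Proof. by move=> f; apply: BfunP => x; rewrite /= mul1r. Qed.
Fact BscaleDr : right_distributive Bscale +%R.
Proof. by move=> c f g; apply: BfunP => x; rewrite /= mulrDr. Qed.
Fact BscaleDl f : {morph Bscale^~ f : c d / c + d}.
Proof. by move=> c d; apply: BfunP => x; rewrite /= mulrDl. Qed.

HB.instance Definition _ :=
  GRing.Zmodule_isLmodule.Build R[i] (Bfun R T) BscaleA Bscale1 BscaleDr BscaleDl.

Lemma BaddE f g x : (f + g) x = f x + g x. Proof. by []. Qed.
Lemma BscaleE c f x : (c *: f) x = c * f x. Proof. by []. Qed.

(* Adjoining 0 makes the supremum meaningful also when T is empty. *)
Definition Bvalues f : set R := 0 |` range (fun x => complex.Re `|f x|).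
Definition Bnorm f : R[i] := (sup (Bvalues f))%:C%C.

Let BReK (z : R[i]) : (complex.Re `|z|)%:C%C = `|z|.
Proof. by rewrite RRe_real// normr_real. Qed.

Let has_sup_Bvalues f : has_sup (Bvalues f).
Proof.
split; first by exists 0; left.
have [M fM] := Bfun_bounded f; exists (complex.Re `|M|) => _ [->|[x _ <-]].
  by rewrite -lecR BReK; exact: normr_ge0.
by rewrite -lecR !BReK [leRHS]ger0_norm // (le_trans _ (fM x)).
Qed.

Lemma Bnorm_ge0 f : 0 <= Bnorm f.
Proof.
by rewrite lecR; apply: sup_upper_bound; [exact: has_sup_Bvalues|left].
Qed.

Lemma le_Bnorm f x : `|f x| <= Bnorm f.
Proof.
rewrite -BReK lecR; apply: sup_upper_bound; first exact: has_sup_Bvalues.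
by right; exists x.
Qed.

Lemma Bnorm_le f c : 0 <= c -> (forall x, `|f x| <= c) -> Bnorm f <= c.
Proof.
move=> c0 fc; rewrite -(ger0_norm c0) -BReK lecR; apply: ge_sup.
  by exists 0; left.
move=> _ [->|[x _ <-]]; rewrite -lecR !BReK; first exact: normr_ge0.
by rewrite (ger0_norm c0).
Qed.

Fact BnormD f g : Bnorm (f + g) <= Bnorm f + Bnorm g.
Proof.
apply: Bnorm_le => [|x]; first by rewrite addr_ge0 ?Bnorm_ge0.
by apply: (le_trans (ler_normD _ _)); apply: lerD; exact: le_Bnorm.
Qed.

Let BnormZ_le c f : Bnorm (c *: f) <= `|c| * Bnorm f.
Proof.
apply: Bnorm_le => [|x]; first by rewrite mulr_ge0 ?Bnorm_ge0.
by rewrite BscaleE normrM ler_wpM2l // le_Bnorm.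
Qed.

Fact BnormZ c f : Bnorm (c *: f) = `|c| * Bnorm f.
Proof.
apply/eqP; rewrite eq_le BnormZ_le /=; have [->|c0] := eqVneq c 0.
  by rewrite normr0 mul0r Bnorm_ge0.
rewrite -ler_pdivlMl ?normr_gt0 // -normfV.
by rewrite -[in leLHS](scale1r f) -(mulVf c0) -scalerA BnormZ_le.
Qed.

Fact Bnorm0_eq0 f : Bnorm f = 0 -> f = 0.
Proof.
move=> f0; apply: BfunP => x; apply/eqP; rewrite -normr_le0 -f0.
exact: le_Bnorm.
Qed.

HB.instance Definition _ :=
  Lmodule_isNormed.Build R[i] (Bfun R T) BnormD BnormZ Bnorm0_eq0.

(** A Cauchy filter converges pointwise, and the Cauchy condition makes the convergence uniform; so
    the limit is bounded and is the limit in norm. *)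
Fact Bfun_complete (F : set_system (Bfun R T)) :
  ProperFilter F -> cauchy F -> cvg F.
Proof.
move=> FF /cauchyP Fc.
pose ev x (f : Bfun R T) : R[i] := f x.
have evB x f g : `|ev x f - ev x g| <= `|f - g| by exact: (le_Bnorm (f - g) x).
have evl x : ev x @ F --> lim (ev x @ F).
  apply: cauchy_cvg; apply/cauchyP => e e0; have [f Ff] := Fc _ e0.
  exists (ev x f); suff : F (ev x @^-1` ball (ev x f) e) by [].
  apply: filterS Ff => g; rewrite /preimage /= -!ball_normE /ball_ /=.
  exact: le_lt_trans (evB _ _ _).
pose l x : R[i] := lim (ev x @ F).
have lF (e : R[i]) : 0 < e -> \forall f \near F, forall x, `|l x - ev x f| <= e.
  move=> e0; have e20 : 0 < e / 2 by rewrite divr_gt0.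
  have [f Ff] := Fc _ e20.
  have lf x : `|l x - ev x f| <= e / 2.
    apply/ler_addgt0Pl => d d0.
    have Fd : F [set g | `|l x - ev x g| < d].
      by move/(@cvgrPdist_lt _ R[i] _ F) : (evl x) => /(_ _ d0).
    have [g [Fg /= gd]] := filter_ex (filterI Ff Fd).
    apply: (le_trans (ler_distD (ev x g) _ _)); apply: lerD; first exact: ltW.
    rewrite distrC; apply: (le_trans (evB _ _ _)).
    by move: Fg; rewrite -ball_normE /ball_ /=; exact: ltW.
  apply: filterS Ff => g; rewrite -ball_normE /ball_ /= => fg x.
  apply: (le_trans (ler_distD (ev x f) _ _)); rewrite (splitr e).
  by apply: lerD; rewrite ?lf //; apply: (le_trans (evB _ _ _)); exact: ltW.
have lb : exists M, forall x, `|l x| <= M.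
  have [f fl] := filter_ex (lF 1 ltr01); exists (1 + `|f|) => x.
  rewrite -[l x](subrK (ev x f)); apply: (le_trans (ler_normD _ _)).
  by apply: lerD => //; exact: le_Bnorm.
apply/cvg_ex; exists (MkBfun lb).
apply/(@cvgrPdist_le _ (Bfun R T) _ F) => e e0.
by apply: filterS (lF _ e0) => f fl; apply: Bnorm_le; [exact: ltW|exact: fl].
Qed.

HB.instance Definition _ := Uniform_isComplete.Build (Bfun R T) Bfun_complete.

Fact BmulA : associative Bmul.
Proof. by move=> f g h; apply: BfunP => x; rewrite /= mulrA. Qed.
Fact Bmul1l : left_id (Bcst 1) Bmul.
Proof. by move=> f; apply: BfunP => x; rewrite /= mul1r. Qed.
Fact Bmul1r : right_id (Bcst 1) Bmul.
Proof. by move=> f; apply: BfunP => x; rewrite /= mulr1. Qed.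
Fact BmulDl : left_distributive Bmul +%R.
Proof. by move=> f g h; apply: BfunP => x; rewrite /= mulrDl. Qed.
Fact BmulDr : right_distributive Bmul +%R.
Proof. by move=> f g h; apply: BfunP => x; rewrite /= mulrDr. Qed.
Fact BmulZl c f g : Bmul (c *: f) g = c *: Bmul f g.
Proof. by apply: BfunP => x; rewrite /= mulrA. Qed.
Fact BmulZr c f g : Bmul f (c *: g) = c *: Bmul f g.
Proof. by apply: BfunP => x; rewrite /= mulrCA. Qed.
Fact BconjD : {morph Bconj : f g / f + g}.
Proof. by move=> f g; apply: BfunP => x; rewrite /= rmorphD. Qed.
Fact BconjZ c f : Bconj (c *: f) = c^* *: Bconj f.
Proof. by apply: BfunP => x; rewrite /= rmorphM. Qed.
Fact BconjM f g : Bconj (Bmul f g) = Bmul (Bconj g) (Bconj f).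
Proof. by apply: BfunP => x; rewrite /= rmorphM mulrC. Qed.
Fact BconjK : involutive Bconj.
Proof. by move=> f; apply: BfunP => x; rewrite /= conjCK. Qed.
Fact BnormM f g : `|Bmul f g| <= `|f| * `|g|.
Proof.
apply: Bnorm_le => [|x]; first by rewrite mulr_ge0.
by rewrite normrM; apply: ler_pM => //; exact: le_Bnorm.
Qed.
Fact Bnorm_conjM f : `|Bmul (Bconj f) f| = `|f| ^+ 2.
Proof.
apply/eqP; rewrite eq_le; apply/andP; split.
  apply: (le_trans (BnormM _ _)); rewrite expr2 ler_wpM2r //.
  by apply: Bnorm_le => // x; rewrite norm_conjC; exact: le_Bnorm.
(* The supremum need not be attained, so square roots are compared: each [|f x|] is at most the root
   of the norm of [Bmul (Bconj f) f]. *)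
rewrite -[leRHS]sqrtCK ler_pXn2r ?nnegrE ?sqrtC_ge0 //.
apply: Bnorm_le => [|x]; first by rewrite sqrtC_ge0.
rewrite -[leLHS]sqrCK // ler_sqrtC ?nnegrE ?exprn_ge0 //.
by have := le_Bnorm (Bmul (Bconj f) f) x; rewrite /= normrM norm_conjC -expr2.
Qed.

HB.instance Definition _ := isCStarAlgebra.Build R[i] (Bfun R T)
  BmulA Bmul1l Bmul1r BmulDl BmulDr BmulZl BmulZr
  BconjD BconjZ BconjM BconjK BnormM Bnorm_conjM.

End Bfun.

Local Open Scope sesquilinear_scope.

(** * Factorisation of positive semidefinite matrices *)

Section Positive.
Variable C : numClosedFieldType.

(* Diagonalising M = P^* D P in an orthonormal basis gives M = B^* B with
   B = D^(1/2) P. *)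
Lemma psd_factor n (M : 'M[C]_n) :
  (forall i j, M i j = (M j i)^*) ->
  (forall v : 'I_n -> C, 0 <= \sum_i \sum_j v i * M i j * (v j)^*) ->
  exists B : 'M[C]_n, forall i j, M i j = \sum_(k < n) (B k i)^* * B k j.
Proof.
move=> herm psd.
have Mh : M \is hermsymmx.
  rewrite is_hermitianmxE expr0 scale1r; apply/eqP/matrixP => i j.
  by rewrite !mxE herm.
have Mn := hermitian_normalmx Mh.
have Pu := spectral_unitarymx M.
set P := spectralmx M in Pu; set D := spectral_diag M.
have ME : M = P^t* *m diag_mx D *m P.
  by rewrite {1}(orthomx_spectralP Mn) invmx_unitary.
(* The eigenvalue [D 0 k] is the value of the quadratic form at row [k] of [P]. *)
have D0 k : 0 <= D 0 k.
  have -> : D 0 k = (P *m M *m P^t*) k k.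
    rewrite ME !mulmxA (unitarymxP Pu) mul1mx -mulmxA (unitarymxP Pu) mulmx1.
    by rewrite mxE eqxx mulr1n.
  have := psd (P k); rewrite exchange_big /= => /le_trans; apply.
  rewrite mxE le_eqVlt; apply/orP; left; apply/eqP; apply: eq_bigr => j _.
  by rewrite !mxE mulr_suml.
exists (\matrix_(k, i) (sqrtC (D 0 k) * P k i)) => i j.
rewrite {1}ME mxE; apply: eq_bigr => k _.
rewrite mul_mx_diag !mxE rmorphM /= (conj_Creal (x := sqrtC _)); last first.
  by rewrite ger0_real // sqrtC_ge0.
by rewrite mulrACA -expr2 sqrtCK mulrCA mulrA.
Qed.

End Positive.

(** * States of C(X) *)

Section ComplexReal.
Variable R : realType.
Implicit Types (z w : R[i]) (a : R).

Lemma ge0_Re z : 0 <= z -> z = (complex.Re z)%:C%C /\ 0 <= complex.Re z.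
Proof. by case: z => a b; rewrite lecE /= => /andP[/eqP -> ->]. Qed.

Lemma ge0_realC a : (0 <= a%:C%C :> R[i]) = (0 <= a).
Proof. by rewrite lecE /= eqxx. Qed.

Lemma conj_mul_ge0 z : 0 <= z^* * z.
Proof. by rewrite mulrC mul_conjC_ge0. Qed.

Lemma conj_rect a b :
  (a%:C%C + 'i%C * b%:C%C)^* = a%:C%C - 'i%C * b%:C%C :> R[i].
Proof. by apply/eqP; rewrite eq_complex /=; apply/andP; split; apply/eqP; ring. Qed.

Lemma Re_rect a b : complex.Re (a%:C%C + 'i%C * b%:C%C) = a.
Proof. by rewrite /=; ring. Qed.

Lemma Im_rect a b : complex.Im (a%:C%C + 'i%C * b%:C%C) = b.
Proof. by rewrite /=; ring. Qed.

Lemma realC_continuous : continuous (fun a : R => a%:C%C : R[i]).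
Proof.
move=> a; apply/(@cvgrPdist_lt _ R[i] R (nbhs a) (nbhs_filter a)) => _ /complex_gt0[e e0 ->].
apply: filterS (nbhsx_ballx a _ e0) => b; rewrite -ball_normE /ball_ /= => ab.
by rewrite -rmorphB /= normc_def /= expr0n addr0 sqrtr_sqr ltcR.
Qed.

Lemma Im_continuous : continuous (@complex.Im R : R[i] -> R).
Proof.
move=> z; apply/(@cvgrPdist_lt _ R R[i] (nbhs z) (nbhs_filter z)) => e e0.
have e0' : 0 < e%:C%C :> R[i] by rewrite ltcR.
apply: filterS (nbhsx_ballx z _ e0') => w; rewrite -ball_normE /ball_ /= => zw.
by rewrite -ImB -ltcR; apply: (le_lt_trans (le_Im_norm _)).
Qed.

End ComplexReal.

Section RealParts.
Variables (R : realType) (X : compHausType).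

Lemma CRe_cont (f : Cfun R X) : continuous (fun x => complex.Re (f x)).
Proof.
move=> x; apply: (@continuous_comp _ _ _ f (@complex.Re R)).
  exact: Cfun_continuous.
exact: Re_continuous.
Qed.

Lemma CIm_cont (f : Cfun R X) : continuous (fun x => complex.Im (f x)).
Proof.
move=> x; apply: (@continuous_comp _ _ _ f (@complex.Im R)).
  exact: Cfun_continuous.
exact: Im_continuous.
Qed.

Lemma realC_cont (f : X -> R) : continuous f -> continuous (fun x => (f x)%:C%C).
Proof.
move=> cf x; apply: (@continuous_comp _ _ _ f (fun a : R => a%:C%C : R[i])).
  exact: cf.
exact: realC_continuous.
Qed.


Definition toC (f : X -> R) (cf : continuous f) : Cfun R X :=
  MkCfun (realC_cont cf).

Lemma Cfun_ReIm (f : Cfun R X) : f = toC (@CRe_cont f) + 'i%C *: toC (@CIm_cont f).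
Proof.
apply: CfunP => x; rewrite CaddE CscaleE /= [LHS]complexE.
by [].
Qed.

End RealParts.

Section States.
Variables (R : realType) (X : compHausType).

(** Positivity is asked of single functions only; [state_mx_pos] derives the matrix version. *)
Record state (S : Cfun R X -> R[i]) : Prop := {
  stateD : forall f g, S (f + g) = S f + S g;
  stateZ : forall c f, S (c *: f) = c * S f;
  state1 : S (Cone R X) = 1;
  state_ge0 : forall f : Cfun R X, (forall x, 0 <= f x) -> 0 <= S f
}.

Lemma state_ev (x : X) : state (fun f => f x).
Proof. by split => // f; apply. Qed.

Variables (S : Cfun R X -> R[i]) (stS : state S).

Lemma state0 : S 0 = 0.
Proof. by rewrite -(scale0r (0 : Cfun R X)) stateZ // mul0r. Qed.

Lemma stateB f g : S (f - g) = S f - S g.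
Proof. by rewrite -scaleN1r stateD // stateZ // mulN1r. Qed.

Lemma state_sum n (F : 'I_n -> Cfun R X) : S (\sum_i F i) = \sum_i S (F i).
Proof. exact: (big_morph S (stateD stS) state0). Qed.

(** Both [M - f] and [M + f] are nonnegative. Being nonnegative in [R[i]] includes being real, so
    this yields reality of the value as well as the bound. *)
Lemma state_real (f : X -> R) (cf : continuous f) (M : R) :
  (forall x, `|f x| <= M) ->
  S (toC cf) = (complex.Re (S (toC cf)))%:C%C /\ `|complex.Re (S (toC cf))| <= M.
Proof.
move=> fM.
have SM : S (M%:C%C *: Cone R X) = M%:C%C by rewrite stateZ // state1 // mulr1.
have h1 : 0 <= S (M%:C%C *: Cone R X - toC cf).
  apply: state_ge0 => // x; rewrite CsubE CscaleE /= mulr1 -rmorphB ge0_realC.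
  by rewrite subr_ge0; apply: (le_trans (ler_norm _)).
have h2 : 0 <= S (M%:C%C *: Cone R X + toC cf).
  apply: state_ge0 => // x; rewrite CaddE CscaleE /= mulr1 -rmorphD ge0_realC.
  by rewrite -lerBlDr sub0r; apply: (le_trans (ler_norm _)); rewrite normrN.
move: h1 h2; rewrite stateB stateD // SM.
case: (S (toC cf)) => a b; rewrite !lecE /= => /andP[/eqP b0 h1] /andP[_ h2].
have -> : b = 0 by move: b0; rewrite sub0r => /eqP; rewrite oppr_eq0 => /eqP.
by split => //; rewrite ler_norml; apply/andP; split; lra.
Qed.

Lemma state_toC (f : X -> R) (cf : continuous f) :
  S (toC cf) = (complex.Re (S (toC cf)))%:C%C.
Proof. by have [M _ /(state_real cf)[]] := cont_bounded cf. Qed.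

Lemma state_conj f : S (Cconj f) = (S f)^*.
Proof.
have -> : Cconj f = toC (@CRe_cont R X f) - 'i%C *: toC (@CIm_cont R X f).
  apply: CfunP => x; rewrite CsubE CscaleE /= -conj_rect.
  by rewrite {1}(complexE (f x)).
rewrite [in RHS](Cfun_ReIm f) stateB stateD // !stateZ //.
by rewrite (state_toC (@CRe_cont R X f)) (state_toC (@CIm_cont R X f)) conj_rect.
Qed.

End States.

(** The bound is uniform in [S], which makes evaluation of states at [f] a bounded function of the
    state. *)
Lemma state_bounded (R : realType) (X : compHausType) (f : Cfun R X) :
  exists M : R[i], forall S : Cfun R X -> R[i], state S -> `|S f| <= M.
Proof.
have [M1 _ h1] := cont_bounded (@CRe_cont R X f).
have [M2 _ h2] := cont_bounded (@CIm_cont R X f).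
exists (M1 + M2)%:C%C => S stS.
rewrite {1}(Cfun_ReIm f) stateD // stateZ //.
have [-> h1'] := state_real stS (@CRe_cont R X f) h1.
have [-> h2'] := state_real stS (@CIm_cont R X f) h2.
apply: (le_trans (le_norm_ReIm _)); rewrite lecR.
set a := complex.Re _ in h1' *; set b := complex.Re _ in h2' *.
by rewrite Re_rect Im_rect; apply: lerD.
Qed.

(** * States as Radon probability measures *)

Section StatesAndMeasures.
Variables (R : realType) (X : compHausType).

(** The default 0 at discontinuous [f] makes this a total functional on [X -> R], the form in which
    the Riesz theorem is stated. *)
Definition real_part (S : Cfun R X -> R[i]) (f : X -> R) : R :=
  if pselect (continuous f) is left cf then complex.Re (S (toC cf)) else 0.

Lemma real_partE S (f : X -> R) (cf : continuous f) :
  real_part S f = complex.Re (S (toC cf)).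
Proof.
rewrite /real_part; case: pselect => // cf'.
by congr (complex.Re (S _)); apply: CfunP.
Qed.

Lemma state_radon (S : Cfun R X -> R[i]) : state S ->
  exists mu : radon_prob R X, forall (f : X -> R) (cf : continuous f),
    S (toC cf) = (rint mu f)%:C%C.
Proof.
move=> stS.
have LD (f g : X -> R) : continuous f -> continuous g ->
    real_part S (fun x => f x + g x) = real_part S f + real_part S g.
  move=> cf cg; rewrite (real_partE _ (contD cf cg)) !real_partE.
  have -> : toC (contD cf cg) = toC cf + toC cg.
    by apply: CfunP => x; rewrite CaddE /= rmorphD.
  by rewrite stateD //; case: (S _) => ? ?; case: (S _).
have LZ (c : R) (f : X -> R) : continuous f ->
    real_part S (fun x => c * f x) = c * real_part S f.
  move=> cf; rewrite (real_partE _ (contZ (c := c) cf)) !real_partE.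
  have -> : toC (contZ (c := c) cf) = c%:C%C *: toC cf.
    by apply: CfunP => x; rewrite CscaleE /= rmorphM.
  by rewrite stateZ //; case: (S _) => ? ? /=; rewrite mul0r subr0.
have L_ge0 (f : X -> R) : continuous f -> (forall x, 0 <= f x) ->
    0 <= real_part S f.
  move=> cf f0; rewrite real_partE.
  have /ge0_Re[_ //] : 0 <= S (toC cf).
  by apply: state_ge0 => // x; rewrite ge0_realC.
have L1 : real_part S (fun=> 1) = 1.
  rewrite (real_partE _ (@cont_cst R X 1)).
  by rewrite (_ : toC _ = Cone R X) ?state1 //; exact: CfunP.
exists (riesz_radon LD LZ L_ge0 L1) => f cf.
by rewrite riesz_representation // real_partE -state_toC.
Qed.

Variable mu : radon_prob R X.

Definition radon_state (f : Cfun R X) : R[i] :=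
  Complex (rint mu (fun x => complex.Re (f x))) (rint mu (fun x => complex.Im (f x))).

Lemma radon_stateE (f : X -> R) (cf : continuous f) :
  radon_state (toC cf) = (rint mu f)%:C%C.
Proof.
apply/eqP; rewrite eq_complex /= eqxx /=.
have -> : (fun x : X => 0 : R) = (fun x => 0 * (fun=> 1) x).
  by apply/funext => x; rewrite mul0r.
by rewrite rintZ ?mul0r //; exact: cont_cst.
Qed.

Lemma radon_state_state : state radon_state.
Proof.
split.
- move=> f g; apply/eqP; rewrite eq_complex /= -!rintD;
    [|exact: CIm_cont|exact: CIm_cont|exact: CRe_cont|exact: CRe_cont].
  by apply/andP; split; apply/eqP; congr rint; apply/funext => x;
    rewrite ?CaddE; case: (f x) => ? ?; case: (g x).
- move=> [c1 c2] f; apply/eqP; rewrite eq_complex /=.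
  have [cR cI] := (@CRe_cont R X f, @CIm_cont R X f).
  rewrite -!rintZ // -rintD; [|exact: contZ|exact: contZ].
  have -> : rint mu (fun x => c1 * complex.Re (f x)) -
      rint mu (fun x => c2 * complex.Im (f x)) =
      rint mu (fun x => c1 * complex.Re (f x) +
        -1 * (c2 * complex.Im (f x))).
    rewrite rintD; [|exact: contZ|by apply: contZ; exact: contZ].
    by congr (_ + _); rewrite [in RHS]rintZ ?mulN1r //; exact: contZ.
  by apply/andP; split; apply/eqP; congr rint; apply/funext => x;
    rewrite ?CscaleE; case: (f x) => ? ? /=; ring.
- rewrite (_ : Cone R X = toC (@cont_cst R X 1)); last exact: CfunP.
  by rewrite radon_stateE rint1.
- move=> f f0; have -> : f = toC (@CRe_cont R X f).
    by apply: CfunP => x /=; case: (ge0_Re (f0 x)).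
  rewrite radon_stateE ge0_realC; apply: rint_ge0 => x.
  by case: (ge0_Re (f0 x)).
Qed.

End StatesAndMeasures.

(** The topology of pointwise convergence is the supremum of the topologies induced by the
    evaluations. *)
Lemma ptws_cvgP (U : Type) (V : topologicalType) (F : set_system (U -> V))
    (h : U -> V) : Filter F ->
  F --> (h : {ptws U -> V}) <-> forall t, (fun g => g t) @ F --> h t.
Proof.
move=> FF; split.
  move=> /cvg_sup Fh t A; rewrite nbhsE => -[B [oB Bht] BA].
  apply: (Fh t); exists ((fun g : U -> V => g t) @^-1` B).
    split => //.
    have w : wopen (fun g : U -> V => g t) ((fun g => g t) @^-1` B) by exists B.
    exact: w.
  by move=> g; exact: BA.
move=> Fh; apply/cvg_sup => t A [_ [[B oB <-] Bht] BA].
by apply: filterS BA _; apply: (Fh t); exact: open_nbhs_nbhs.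
Qed.

(** * Integrals and the weak* topology *)

Section RadonTopology.
Variable R : realType.

Lemma rint_push (X Y : compHausType) (h : X -> Y) (ch : continuous h)
    (mu : radon_prob R X) (f : Y -> R) : continuous f ->
  rint (radon_push ch mu) f = rint mu (fun x => f (h x)).
Proof.
move=> cf; rewrite /rint /Rintegral; congr fine.
apply: (@integral_distribution _ _ _ _ R mu (borel_map ch) (EFin \o f)).
  by apply/measurable_EFinP; exact: cont_measurable.
apply: (@cont_integrable R X mu (fun x => f (h x))) => x.
by apply: (@continuous_comp _ _ _ h f); [exact: ch|exact: cf].
Qed.

Variable X : compHausType.

Lemma rint_point_mass (x : X) (f : X -> R) : continuous f ->
  rint (point_mass R x) f = f x.
Proof.
move=> cf; rewrite /rint /Rintegral.
rewrite (@integral_dirac _ (borel X) x R setT measurableT (EFin \o f)).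
  by rewrite diracT mul1e.
by apply/measurable_EFinP; exact: cont_measurable.
Qed.

Lemma rint_continuous (f : X -> R) : continuous f ->
  continuous (fun mu : radon_prob R X => rint mu f).
Proof.
move=> cf; pose F : continuousType X R := HB.pack f (isContinuous.Build X R f cf).
move=> mu.
have : @radon_pairing R X @ mu --> (@radon_pairing R X mu : {ptws continuousType X R -> R}).
  exact: (@initial_continuous _ _ (@radon_pairing R X)).
move=> /ptws_cvgP h; have FF := fmap_filter (@radon_pairing R X) (nbhs_filter mu).
by have := h FF F.
Qed.

(** The weak* topology is induced by [radon_pairing], so convergence may be tested on the pairings,
    where it is pointwise. *)
Lemma radon_cvg (F : set_system (radon_prob R X)) (nu : radon_prob R X) :
  Filter F ->
  (forall f : X -> R, continuous f -> (fun mu => rint mu f) @ F --> rint nu f) ->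
  F --> nu.
Proof.
move=> FF h A; rewrite nbhsE => -[B [[U oU UB] Bnu] BA].
apply: filterS BA _; rewrite -UB.
have : @radon_pairing R X @ F --> (@radon_pairing R X nu : {ptws continuousType X R -> R}).
  apply/ptws_cvgP => f.
  by apply: (h f); exact: cts_fun.
move=> /(_ U) h'; apply: h'; apply: open_nbhs_nbhs; split => //.
by move: Bnu; rewrite -UB.
Qed.

End RadonTopology.

(** * The Hamana boundary *)

Section Injections.
Variable R : realType.

Lemma ucp_comp (S T U : opsys R) (f : os_alg S -> os_alg T) (g : os_alg T -> os_alg U) :
  ucp S T f -> ucp T U g -> ucp S U (fun x => g (f x)).
Proof.
move=> uf ug; split.
- by move=> x /(ucp_fun uf) /(ucp_fun ug).
- move=> x y Sx Sy; rewrite (ucp_add uf) // (ucp_add ug) //;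
    exact: (ucp_fun uf).
- by move=> c x Sx; rewrite (ucp_scale uf) // (ucp_scale ug) //; exact: (ucp_fun uf).
- by rewrite (ucp_one uf) (ucp_one ug).
- move=> n M SM Mp.
  have -> : map_mx (fun x => g (f x)) M = map_mx g (map_mx f M).
    by apply/matrixP => i j; rewrite !mxE.
  apply: (ucp_pos ug); last exact: (ucp_pos uf).
  by move=> i j; rewrite mxE; exact: (ucp_fun uf).
Qed.

Lemma star_cone (A : cstarAlgType R[i]) : star (cone : A) = cone.
Proof.
rewrite -[RHS](starK (cone : A)).
by rewrite -[in RHS](cmul1r (star cone)) starM starK cmul1r.
Qed.

Lemma scalar_ucp (S : opsys R) :
  ucp (full_opsys R[i]) S (fun c : R[i] => c *: (cone : os_alg S)).
Proof.
split.
- by move=> c _; apply: os_scale; exact: os_one.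
- by move=> c d _ _; rewrite scalerDl.
- by move=> c d _; rewrite scalerA.
- exact: scale1r.
- move=> n M _ [B MB]; exists (map_mx (fun c : R[i] => c *: (cone : os_alg S)) B).
  move=> i j; rewrite !mxE MB scaler_suml; apply: eq_bigr => k _.
  by rewrite !mxE starZ star_cone cmulZl cmulZr cmul1l scalerA.
Qed.

(* Any state chi detects positivity of scalar matrices, since chi (c 1) = c. *)
Lemma scalar_injection (S : opsys R) (chi : os_alg S -> R[i]) :
  ucp S (full_opsys R[i]) chi ->
  complete_order_injection (full_opsys R[i]) S (fun c : R[i] => c *: (cone : os_alg S)).
Proof.
move=> uchi.
have chiE (c : R[i]) : chi (c *: (cone : os_alg S)) = c.
  rewrite (ucp_scale uchi) ?(ucp_one uchi); last exact: os_one.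
  exact: mulr1.
split; first exact: scalar_ucp.
- by move=> c d _ _ cd; rewrite -(chiE c) cd chiE.
- move=> n M _ Mp.
  have := @ucp_pos _ _ _ _ uchi n (map_mx (fun c : R[i] => c *: (cone : os_alg S)) M).
  have -> : map_mx chi (map_mx (fun c : R[i] => c *: (cone : os_alg S)) M) = M.
    by apply/matrixP => i j; rewrite !mxE chiE.
  apply => // i j; rewrite mxE; apply: os_scale; exact: os_one.
Qed.

Variable G : groupoid.

(** The maps [chi u], of which no equivariance is asked, make the scalar inclusion of the trivial
    system into [B] an injection. Injectivity extends the embedding [T0] along it to [Theta]. Then
    [Theta] after [P] fixes the scalars, and rigidity makes it the identity. *)
Lemma hamana_retraction (X : gspace G) (B : gsystem R G)
    (chi : forall u, os_alg (B u) -> R[i]) (P : sys_map (C_system R X) B) :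
  hamana_boundary R X -> (forall u, ucp (B u) (full_opsys R[i]) (chi u)) ->
  sys_morphism P ->
  exists2 Theta : sys_map B (C_system R X), sys_morphism Theta &
    forall u f, Theta u (P u f) = f.
Proof.
move=> [inj [T0 [[uT0 _] _] rigid]] uchi [uP eP].
pose inc : sys_map (trivial_system R G) B := fun u c => c *: (cone : os_alg (B u)).
have inc_inj : sys_injection inc.
  split; last by move=> u; exact: scalar_injection (uchi u).
  split=> [u|u v g c _]; first exact: scalar_ucp.
  have [ug _] := sys_act_iso B g.
  by rewrite (ucp_scale ug) ?(ucp_one ug) //; exact: os_one.
(* Linearity and unitality force the embedding of the envelope to be the scalar one. *)
have T0E u c : T0 u c = c *: (cone : Cfun R (X u)).
  rewrite -[in LHS](mulr1 c : c *: (1 : R[i]) = c) (ucp_scale (uT0 u)) //.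
  by congr (_ *: _); exact: (ucp_one (uT0 u)).
have [|Theta [uTheta eTheta] ThetaE] := inj _ _ inc T0 inc_inj.
  split => //; by move=> u v g c _; rewrite !T0E; apply: CfunP.
exists Theta; first by split.
move=> u f; apply: (rigid (fun u f => Theta u (P u f))) => //.
- split=> [w|w v g x _]; first exact: ucp_comp (uP w) (uTheta w).
  rewrite eTheta ?eP //; exact: (ucp_fun (uP w)).
- move=> w c _; rewrite T0E (ucp_scale (uP w)) // (ucp_scale (uTheta w)).
    by rewrite (ucp_one (uP w)) (ucp_one (uTheta w)).
  exact: (ucp_fun (uP w)).
Qed.

End Injections.

Lemma ginv_unit (G : groupoid) (u : G) : ginv (gunit u) = gunit u.
Proof. by apply/esym/ginv_unique; rewrite gcomp1l. Qed.

(** * Complete positivity of states, and positivity of u.c.p. maps *)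

Section Positivity.
Variable R : realType.

(** With [M = N^* N], the quadratic form of the matrix of values at [v] is [S] of the sum of the
    functions [|h k|^2], where [h k] is the combination of row [k] of [N] with coefficients
    [(v i)^*]. It is therefore nonnegative and [psd_factor] applies. *)
Lemma state_mx_pos (Z : compHausType) (S : Cfun R Z -> R[i]) n
    (M : 'M[Cfun R Z]_n) : state S -> mx_pos M ->
  exists B : 'M[R[i]]_n, forall i j, S (M i j) = \sum_(k < n) (B k i)^* * B k j.
Proof.
move=> stS [N MN].
have [|v|B hB] := @psd_factor _ n (map_mx S M).
- move=> i j; rewrite !mxE -state_conj //; congr S; apply: CfunP => x.
  rewrite /= !MN.
  have ev (F : 'I_n -> Cfun R Z) : (\sum_k F k) x = \sum_k F k x.
    exact: (big_morph (fun f : Cfun R Z => f x) (fun f g => CaddE f g x) erefl).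
  rewrite !ev rmorph_sum; apply: eq_bigr => k _ /=.
  by rewrite rmorphM /= conjCK mulrC.
- pose h k : Cfun R Z := \sum_i (v i)^* *: N k i.
  have -> : \sum_i \sum_j v i * map_mx S M i j * (v j)^* =
      S (\sum_k Cmul (Cconj (h k)) (h k)).
    transitivity (S (\sum_i \sum_j (v i * (v j)^*) *: M i j)).
      rewrite state_sum //; apply: eq_bigr => i _.
      rewrite state_sum //; apply: eq_bigr => j _.
      by rewrite stateZ // mxE mulrAC.
    congr S; apply: CfunP => x.
    have ev (F : 'I_n -> Cfun R Z) : (\sum_k F k) x = \sum_k F k x.
      exact: (big_morph (fun f : Cfun R Z => f x) (fun f g => CaddE f g x) erefl).
    transitivity (\sum_i \sum_j \sum_k
        (v i * (v j)^*) * ((N k i x)^* * N k j x)).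
      rewrite ev; apply: eq_bigr => i _; rewrite ev; apply: eq_bigr => j _.
      by rewrite -mulr_sumr MN CscaleE ev.
    under eq_bigr => i _ do rewrite exchange_big.
    rewrite exchange_big [RHS]ev /=; apply: eq_bigr => k _.
    rewrite /h !ev rmorph_sum /= mulr_suml; apply: eq_bigr => i _.
    rewrite mulr_sumr; apply: eq_bigr => j _.
    by rewrite ?CscaleE /= ?rmorphM /= ?conjCK; ring.
  apply: state_ge0 => // x.
  have -> : (\sum_k Cmul (Cconj (h k)) (h k)) x = \sum_k (h k x)^* * h k x.
    exact: (big_morph (fun f : Cfun R Z => f x) (fun f g => CaddE f g x) erefl).
  by apply: sumr_ge0 => k _; exact: conj_mul_ge0.
- by exists B => i j; rewrite -hB mxE.
Qed.

Lemma norm_le_sqr (b c : R[i]) : b^* * b <= c -> `|b| <= sqrtC c.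
Proof.
rewrite mulrC -normCK => h; rewrite -[leLHS]sqrCK //.
by rewrite ler_sqrtC // nnegrE ?exprn_ge0 // (le_trans _ h) ?exprn_ge0.
Qed.

(** Complete positivity at matrix size 1, applied to the factorisation of [F] by its pointwise
    square root. *)
Lemma ucp_Bfun_ge0 (T : Type) (Z : compHausType) (Phi : Bfun R T -> Cfun R Z)
    (F : Bfun R T) (z : Z) :
  ucp (full_opsys (Bfun R T)) (full_opsys (Cfun R Z)) Phi ->
  (forall t, 0 <= F t) -> 0 <= Phi F z.
Proof.
move=> uPhi F0.
have Rb : exists M : R[i], forall t, `|sqrtC (F t)| <= M.
  have [M FM] := Bfun_bounded F; exists (sqrtC M) => t; apply: norm_le_sqr.
  rewrite mulrC -normCK ger0_norm ?sqrtC_ge0 // sqrtCK.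
  by rewrite -(ger0_norm (F0 t)).
have : mx_pos (map_mx Phi (const_mx F : 'M[Bfun R T]_1)).
  apply: (ucp_pos uPhi) => //; exists (const_mx (MkBfun Rb)) => i j.
  rewrite big_ord1 !mxE; apply: BfunP => t /=.
  by rewrite conj_Creal ?ger0_real ?sqrtC_ge0 // -expr2 sqrtCK.
by move=> [B /(_ 0 0)]; rewrite big_ord1 !mxE => ->; exact: conj_mul_ge0.
Qed.

End Positivity.

(** * The G-system of bounded functions on an invariant family of states *)

Section StateSystem.
Variables (R : realType) (G : groupoid) (X : gspace G).

Variable Y : forall u, (Cfun R (X u) -> R[i]) -> Prop.
Hypothesis Y_state : forall u S, Y (u := u) S -> state S.
Hypothesis Y_inv : forall u v (g : arrow u v) S,
  Y S -> Y (fun f : Cfun R (X v) => S (C_act (ginv g) f)).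

Definition Ypt (u : G) : Type := {S : Cfun R (X u) -> R[i] | Y S}.

Lemma YptP u (s t : Ypt u) : (forall f, sval s f = sval t f) -> s = t.
Proof.
case: s t => [S YS] [T YT] /= /funext ST; move: YS; rewrite ST => YS.
by congr exist; exact: Prop_irrelevance.
Qed.

Definition Yact u v (g : arrow u v) (s : Ypt u) : Ypt v :=
  exist _ _ (Y_inv g (svalP s)).

Lemma Bact_bounded u v (g : arrow u v) (F : Bfun R (Ypt u)) :
  exists M : R[i], forall t : Ypt v, `|F (Yact (ginv g) t)| <= M.
Proof. by have [M FM] := Bfun_bounded F; exists M => t. Qed.

Definition Bact u v (g : arrow u v) (F : Bfun R (Ypt u)) : Bfun R (Ypt v) :=
  MkBfun (Bact_bounded g F).

Lemma Bact_ucp u v (g : arrow u v) :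
  ucp (full_opsys (Bfun R (Ypt u))) (full_opsys (Bfun R (Ypt v))) (Bact g).
Proof. by apply: star_hom_ucp => [F H|c F||F H|F]; exact: BfunP. Qed.

Lemma C_act1 u (f : Cfun R (X u)) : C_act (gunit u) f = f.
Proof. by apply: CfunP => x /=; rewrite ginv_unit sp_act1. Qed.

Lemma C_act_comp u v w (g : arrow v w) (h : arrow u v) (f : Cfun R (X u)) :
  C_act g (C_act h f) = C_act (gcomp g h) f.
Proof. exact: C_actM. Qed.

Lemma Yact1 u (s : Ypt u) : Yact (gunit u) s = s.
Proof. by apply: YptP => f /=; rewrite ginv_unit C_act1. Qed.

Lemma YactM u v w (g : arrow v w) (h : arrow u v) (s : Ypt u) :
  Yact g (Yact h s) = Yact (gcomp g h) s.
Proof. by apply: YptP => f /=; rewrite C_act_comp ginvM. Qed.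

Lemma Bact_iso u v (g : arrow u v) : complete_order_iso
  (full_opsys (Bfun R (Ypt u))) (full_opsys (Bfun R (Ypt v))) (Bact g).
Proof.
split; first exact: Bact_ucp.
exists (Bact (ginv g)); first exact: Bact_ucp.
by split=> F _; apply: BfunP => s /=;
  rewrite YactM ?ginvK ?gcompVl ?gcompVr Yact1.
Qed.

Lemma BactM u v w (g : arrow v w) (h : arrow u v) (F : Bfun R (Ypt u)) :
  os_set (full_opsys (Bfun R (Ypt u))) F ->
  Bact g (Bact h F) = Bact (gcomp g h) F.
Proof. by move=> _; apply: BfunP => s /=; rewrite YactM ginvM. Qed.

Definition state_system : gsystem R G :=
  @GSystem R G (fun u => full_opsys (Bfun R (Ypt u))) Bact Bact_iso BactM.

Lemma poisson_bounded u (f : Cfun R (X u)) :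
  exists M : R[i], forall s : Ypt u, `|sval s f| <= M.
Proof.
have [M SM] := state_bounded f; exists M => s.
by apply: SM; exact: Y_state (svalP s).
Qed.

(** When [Y] is the orbit of one measure [mu], this is the Poisson transform, sending [f] to its
    integrals against the translates of [mu]. *)
Definition poisson u (f : Cfun R (X u)) : Bfun R (Ypt u) :=
  MkBfun (poisson_bounded f).

Lemma poisson_ucp u :
  ucp (full_opsys (Cfun R (X u))) (full_opsys (Bfun R (Ypt u))) (@poisson u).
Proof.
split=> //.
- by move=> f g _ _; apply: BfunP => s /=; rewrite stateD //; exact: Y_state (svalP s).
- by move=> c f _; apply: BfunP => s /=; rewrite stateZ //; exact: Y_state (svalP s).
- by apply: BfunP => s /=; rewrite state1 //; exact: Y_state (svalP s).
- move=> n M _ Mp.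
  have /choice[B hB] (s : Ypt u) := state_mx_pos (Y_state (svalP s)) Mp.
  (* The factors [B s] are chosen separately for each [s]. They are nevertheless uniformly bounded,
     because the squares [|B s k i|^2] sum over [k] to the value of [s] at [M i i]. *)
  have Bb k i : exists c : R[i], forall s, `|B s k i| <= c.
    have [c hc] := poisson_bounded (M i i); exists (sqrtC c) => s.
    apply: norm_le_sqr.
    have Sge0 : 0 <= sval s (M i i).
      by rewrite hB; apply: sumr_ge0 => l _; exact: conj_mul_ge0.
    apply: (le_trans _ (hc s)); rewrite (ger0_norm Sge0) hB (bigD1 k) //= lerDl.
    by apply: sumr_ge0 => l _; exact: conj_mul_ge0.
  exists (\matrix_(k, i) MkBfun (Bb k i)) => i j; apply: BfunP => s.
  rewrite mxE /= hB.
  have -> : (\sum_(k < n) cmul (star ((\matrix_(k, i) MkBfun (Bb k i)) k i))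
      ((\matrix_(k, i) MkBfun (Bb k i)) k j) : Bfun R (Ypt u)) s =
      \sum_(k < n) (cmul (star ((\matrix_(k, i) MkBfun (Bb k i)) k i))
      ((\matrix_(k, i) MkBfun (Bb k i)) k j) : Bfun R (Ypt u)) s.
    exact: (big_morph (fun f : Bfun R (Ypt u) => f s) (fun f g => BaddE f g s) erefl).
  by apply: eq_bigr => k _; rewrite !mxE.
Qed.

Lemma poisson_morphism : @sys_morphism R G (C_system R X) state_system poisson.
Proof.
split=> [|u v g f _]; first exact: poisson_ucp.
by apply: BfunP => s /=; rewrite ginvK.
Qed.

Hypothesis Y0 : forall u, exists S, Y (u := u) S.
Hypothesis hamanaX : hamana_boundary R X.

(** By [hamana_retraction], [f] is [Theta (poisson f)], the image of a nonnegative function.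
    Evaluation at a chosen point [s0 w] of each [Ypt w] supplies the states that the retraction asks
    for. *)
Lemma hamana_states_ge0 u (f : Cfun R (X u)) x :
  (forall S, Y S -> 0 <= S f) -> 0 <= f x.
Proof.
move=> f0.
pose s0 w : Ypt w := exist _ (projT1 (cid (Y0 w))) (projT2 (cid (Y0 w))).
have [|Theta [uTheta _] ThetaP] := @hamana_retraction R G X state_system
    (fun w F => F (s0 w)) poisson hamanaX _ poisson_morphism.
  by move=> w; exact: star_hom_ucp.
rewrite -(ThetaP u f); apply: ucp_Bfun_ge0; first exact: (uTheta u).
by move=> s; apply: f0; exact: svalP s.
Qed.

End StateSystem.

(** * Minimality and strong proximality of the Hamana boundary *)

Section HamanaBoundary.
Variables (R : realType) (G : groupoid) (X : gspace G).
Hypothesis hamanaX : hamana_boundary R X.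

Lemma sp_actK u v (g : arrow u v) (x : X u) : sp_act (ginv g) (sp_act g x) = x.
Proof. by rewrite sp_actM gcompVl sp_act1. Qed.

Lemma sp_actVK u v (g : arrow u v) (x : X v) : sp_act g (sp_act (ginv g) x) = x.
Proof. by rewrite sp_actM gcompVr sp_act1. Qed.

(** If [x] were outside [Y u], a Urysohn function [h] with [h x = 1] and [h = 0] on [Y u] would make
    [-1 * h] nonnegative at every evaluation in [Y u] but negative at [x]. *)
Lemma hamana_minimal : gminimal X.
Proof.
move=> Y [cY aY] u; rewrite -subTset => x _; apply: contrapT => nYx.
have oY : open (~` Y u).
  by rewrite openC; apply: compact_closed; [exact: hausdorffT|case: (cY u)].
have [h [ch _ h0 h1]] := @urysohn_point R (X u) x _ oY nYx.
pose Z w (S : Cfun R (X w) -> R[i]) := exists2 y, Y w y & S = fun f => f y.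
have cnh : continuous (fun y => -1 * h y) by exact: contZ.
have : 0 <= toC cnh x.
  apply: (@hamana_states_ge0 R G X Z) => //.
  - by move=> w S [y _ ->]; exact: state_ev.
  - move=> w v g S [y Yy ->]; exists (sp_act g y).
      by rewrite -(aY _ _ g); exists y.
    by apply/funext => f /=; rewrite ginvK.
  - by move=> w; have [_ [y Yy]] := cY w; exists (fun f => f y), y.
  - by move=> S [y Yy ->]; rewrite /= h0 ?mulr0 // => /(_ Yy).
by rewrite /= h1 mulr1 ge0_realC oppr_ge0 ler10.
Qed.

Lemma radon_act_state u v (g : arrow u v) (mu : radon_prob R (X u)) (f : X v -> R)
    (cf : continuous f) :
  radon_state mu (C_act (ginv g) (toC cf)) = (rint (radon_act g mu) f)%:C%C.
Proof.
have cfg : continuous (fun x => f (sp_act g x)).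
  by move=> x; apply: (@continuous_comp _ _ _ (sp_act g) f);
    [exact: sp_act_cont|exact: cf].
rewrite rint_push // -(radon_stateE _ cfg); congr (radon_state mu _).
by apply: CfunP => x /=; rewrite ginvK.
Qed.

(** Otherwise [(1 - e) - h] has nonnegative integral against the whole orbit, hence is nonnegative,
    although its value at [x] is [-e]. *)
Lemma orbit_concentrates u v (mu : radon_prob R (X u)) (x : X v) (h : X v -> R)
    (e : R) : [set: arrow u v] !=set0 -> continuous h -> h x = 1 -> 0 < e ->
  exists g : arrow u v, 1 - e < rint (radon_act g mu) h.
Proof.
move=> [g0 _] ch hx e0; apply: contrapT => nex.
(* The family must be nonempty over every unit: where no arrow from [u] arrives, all states are
   taken. Arrows preserve whether a unit is reachable from [u], so the family stays invariant. *)
pose Z w (S : Cfun R (X w) -> R[i]) :=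
  (exists g : arrow u w, S = fun f => radon_state mu (C_act (ginv g) f)) \/
  ([set: arrow u w] = set0 /\ state S).
have act_state w w' (g : arrow w w') (S : Cfun R (X w) -> R[i]) : state S ->
    state (fun f => S (C_act (ginv g) f)).
  move=> stS; split.
  - by move=> f1 f2; rewrite -stateD //; congr S; exact: CfunP.
  - by move=> c f1; rewrite -stateZ //; congr S; exact: CfunP.
  - by rewrite -(state1 stS); congr S; exact: CfunP.
  - by move=> f1 f10; apply: state_ge0 => // y; exact: f10.
have cf : continuous (fun y => (1 - e) - h y) by apply: contB => //; exact: cont_cst.
have : 0 <= toC cf x.
  apply: (@hamana_states_ge0 R G X Z) => //.
  - move=> w S [[g ->]|[_ //]]; apply: act_state; exact: radon_state_state.
  - move=> w w' g S [[k ->]|[nw stS]].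
      left; exists (gcomp g k); apply/funext => f.
      by rewrite C_actM // ginvM.
    right; split; last exact: act_state.
    rewrite -subset0 => k _.
    by have : [set: arrow u w] (gcomp (ginv g) k) by []; rewrite nw.
  - move=> w; have [[g _]|nw] := pselect ([set: arrow u w] !=set0).
      by exists (fun f => radon_state mu (C_act (ginv g) f)); left; exists g.
    exists (fun f => f point); right; split; last exact: state_ev.
    by apply: contrapT => /eqP/set0P.
  - move=> S [[g ->]|[nv _]]; last by have : [set: arrow u v] g0 by []; rewrite nv.
    rewrite radon_act_state ge0_realC.
    have -> : (fun y => (1 - e) - h y) = (fun y => (1 - e) * (fun=> 1) y + -1 * h y).
      by apply/funext => y; rewrite mulr1 mulN1r.
    rewrite rintD; [|by apply: contZ; exact: cont_cst|exact: contZ].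
    rewrite !rintZ ?rint1 //; last exact: cont_cst.
    rewrite mulr1 mulN1r subr_ge0 leNgt; apply/negP => hg; apply: nex.
    by exists g.
rewrite /= hx ge0_realC; lra.
Qed.

Lemma hamana_strongly_proximal : strongly_proximal R X.
Proof.
move=> u v mu arr; pose x : X v := point; exists (point_mass R x).
split; last by exists x.
(* A filter of orbit measures that concentrate at [x]: its basic sets are indexed by an open
   neighbourhood [p.1] of [x] and an allowed loss of mass [p.2]. Concentration is expressed by a
   continuous [h] vanishing off [p.1]. *)
pose D := [set p : set (X v) * R | [/\ open p.1, p.1 x & 0 < p.2]].
pose B (p : set (X v) * R) := [set nu | range (fun g : arrow u v => radon_act g mu) nu /\
  exists h : X v -> R, [/\ continuous h, forall y, 0 <= h y <= 1,
    forall y, ~ p.1 y -> h y = 0 & 1 - p.2 < rint nu h]].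
have FF : Filter (filter_from D B).
  apply: filter_from_filter.
    by exists (setT, 1); split => //=; exact: openT.
  move=> [U e] [V d] [/= oU Ux e0] [/= oV Vx d0].
  exists (U `&` V, Num.min e d).
    by split => //=; [exact: openI|rewrite lt_min e0].
  move=> nu [rnu [h [ch h01 h0 hnu]]] /=.
  split; split => //; exists h; split => //.
  - by move=> y nU; apply: h0 => -[].
  - by apply: le_lt_trans hnu; rewrite lerD2l lerN2 ge_min lexx.
  - by move=> y nV; apply: h0 => -[].
  - by apply: le_lt_trans hnu; rewrite lerD2l lerN2 ge_min lexx orbT.
have PF : ProperFilter (filter_from D B).
  apply: filter_from_proper => -[U e] [/= oU Ux e0].
  have [h [ch h01 h0 h1]] := @urysohn_point R (X v) x _ oU Ux.
  have [g hg] := orbit_concentrates mu arr ch h1 e0.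
  exists (radon_act g mu); split; first by exists g.
  by exists h.
suff Fx : filter_from D B --> point_mass R x.
  move=> A /Fx FA.
  have FD : filter_from D B (range (fun g : arrow u v => radon_act g mu)).
    exists (setT, 1); first by split => //=; exact: openT.
    by move=> nu [].
  exact: filter_ex (filterI FD FA).
apply: radon_cvg => f cf; rewrite rint_point_mass //.
apply/(@cvgrPdist_le _ R) => e e0.
have [M M0 fM] := cont_bounded cf.
have e20 : 0 < e / 2 by rewrite divr_gt0.
pose U := [set y | `|f x - f y| < e / 2].
have cfx : continuous (fun y => `|f x - f y|).
  by move=> y; apply: cvg_norm; apply: contB => //; exact: cont_cst.
have oU : open U.
  apply: (@open_comp _ _ (fun y => `|f x - f y|) [set t | t < e / 2]) => [y _|].
    exact: cfx.
  exact: open_lt.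
(* Off [U] the difference [f x - f y] is at most [2 * M] in absolute value, so a loss of mass [d]
   costs at most [e / 2]. *)
pose d := e / 2 / (2 * M).
have M20 : 0 < 2 * M by rewrite mulr_gt0.
exists (U, d).
  by split => //=; [rewrite /U /= subrr normr0|rewrite divr_gt0].
move=> nu [_ [h [ch h01 h0 hnu]]] /=.
(* Integration of the pointwise bound [k * (f x - f y) <= e / 2 + 2 * M * (1 - h y)]; the signs
   [k = 1] and [k = -1] give the two halves of the absolute value. *)
have dominated (k : R) : `|k| = 1 -> k * (f x - rint nu f) <= e.
  move=> k1.
  pose L y := k * (f x - f y).
  have cL : continuous L.
    by apply: contZ; apply: contB => //; exact: cont_cst.
  have Lle y : L y <= e / 2 + 2 * M * (1 - h y).
    apply: (le_trans (ler_norm _)); rewrite /L normrM k1 mul1r.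
    have [/andP[hy0 hy1] hUy] := (h01 y, pselect (U y)); case: hUy => Uy.
      apply: (le_trans (ltW Uy)); rewrite lerDl mulr_ge0 ?(ltW M20) ?subr_ge0 //.
    rewrite h0 // subr0 mulr1; apply: (le_trans (ler_normB _ _)).
    by apply: (le_trans (lerD (fM x) (fM y))); rewrite mulrDl mul1r lerDr ltW.
  have c1 := @cont_cst R (X v) 1.
  have nn : rint nu (fun y => (e / 2 + 2 * M) * (fun=> 1) y + ((- (2 * M)) * h y + -1 * L y)) >= 0.
    by apply: rint_ge0 => y; move: (Lle y); lra.
  have LE : rint nu L = k * (f x - rint nu f).
    have -> : L = (fun y => k * f x * (fun=> 1) y + - k * f y).
      by apply/funext => y; rewrite /L; ring.
    rewrite rintD; [|exact: contZ|exact: contZ].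
    by rewrite !rintZ // rint1; ring.
  move: nn; rewrite rintD; [|exact: contZ|by apply: contD; exact: contZ].
  rewrite rintD; [|exact: contZ|exact: contZ].
  rewrite (@rintZ R (X v) nu _ _ cL) (@rintZ R (X v) nu _ _ ch) (@rintZ R (X v) nu _ _ c1) rint1 LE => nn.
  have dE : 2 * M * d = e / 2 by rewrite /d mulrCA divff ?mulr1 // gt_eqF.
  have : 2 * M * (1 - d) <= 2 * M * rint nu h by rewrite ler_pM2l // ltW.
  rewrite mulrBr dE; lra.
rewrite ler_norml; apply/andP; split; last first.
  by have := dominated 1 (normr1 _); rewrite mul1r.
by have := dominated (-1) (normrN1 _); rewrite mulN1r lerNl.
Qed.

End HamanaBoundary.

(** * Comparison with the Furstenberg boundary *)

Lemma eq_by_functions (R : realType) (X : compHausType) (x y : X) :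
  (forall f : X -> R, continuous f -> f x = f y) -> x = y.
Proof.
move=> h; apply: contrapT => xy.
have oU : open (~` [set y]).
  rewrite openC; apply: accessible_closed_set1; apply: hausdorff_accessible.
  exact: hausdorffT.
have [f [cf _ f0 f1]] := @urysohn_point R X x _ oU xy.
have := h f cf; rewrite f1 f0 => [/eqP|]; first by rewrite oner_eq0.
exact.
Qed.

Lemma cluster_eq0 (R : realType) (T : topologicalType) (F : set_system T)
    (k : T -> R) (p : T) :
  continuous k -> cluster F p -> (forall e, 0 < e -> F [set q | `|k q| < e]) ->
  k p = 0.
Proof.
move=> ck Fp Fk; apply/eqP; rewrite -normr_le0; apply/ler_addgt0Pr => e e0.
rewrite add0r.
have e20 : 0 < e / 2 by rewrite divr_gt0.
have near_p : nbhs p [set q | `|k p - k q| < e / 2].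
  by have /(@cvgrPdist_lt _ R) := ck p; apply.
have [q [/= kq kpq]] := Fp _ _ (Fk _ e20) near_p.
rewrite (splitr e) -[k p](subrK (k q)); apply: (le_trans (ler_normD _ _)).
by apply: lerD; exact: ltW.
Qed.

Lemma C_map_cont (R : realType) (X Y : compHausType) (h : X -> Y)
    (ch : continuous h) (f : Cfun R Y) : continuous (fun x => f (h x)).
Proof.
move=> x; apply: (@continuous_comp _ _ _ h f); first exact: ch.
exact: Cfun_continuous.
Qed.

Definition C_map (R : realType) (X Y : compHausType) (h : X -> Y)
    (ch : continuous h) (f : Cfun R Y) : Cfun R X := MkCfun (@C_map_cont R X Y h ch f).

(** For positivity, a nonnegative continuous function has a continuous square root, so complete
    positivity at matrix size 1 applies. *)
Lemma ucp_Cfun_state (R : realType) (X Y : compHausType)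
    (Phi : Cfun R X -> Cfun R Y) (y : Y) :
  ucp (full_opsys (Cfun R X)) (full_opsys (Cfun R Y)) Phi ->
  state (fun f => Phi f y).
Proof.
move=> uPhi; split.
- by move=> f g; rewrite (ucp_add uPhi).
- by move=> c f; rewrite (ucp_scale uPhi).
- by rewrite (ucp_one uPhi).
- move=> f f0.
  have csq : continuous (fun x => Num.sqrt (complex.Re (f x))).
    move=> x; apply: (@continuous_comp _ _ _ (fun x => complex.Re (f x)) Num.sqrt).
      exact: CRe_cont.
    exact: sqrt_continuous.
  have : mx_pos (map_mx Phi (const_mx f : 'M[Cfun R X]_1)).
    apply: (ucp_pos uPhi) => //; exists (const_mx (toC csq)) => i j.
    rewrite big_ord1 !mxE; apply: CfunP => x /=.
    have [fE Rf0] := ge0_Re (f0 x).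
    rewrite [LHS]fE conj_Creal; last first.
      by rewrite ger0_real // ge0_realC sqrtr_ge0.
    by rewrite -rmorphM /= -expr2 sqr_sqrtr.
  by move=> [B /(_ 0 0)]; rewrite big_ord1 !mxE => ->; exact: conj_mul_ge0.
Qed.

(* A G-morphism from C(X) to C(Y), for X a boundary and Y minimal, is induced by
   a G-map Y -> X: the set of y at which it is a point evaluation is a
   G-subspace, nonempty by strong proximality. *)
Lemma morphism_gmap (R : realType) (G : groupoid) (X Y : gspace G)
    (Theta : sys_map (C_system R X) (C_system R Y)) :
  strongly_proximal R X -> gminimal Y -> sys_morphism Theta ->
  exists2 psi : forall u, Y u -> X u, gmap psi &
    forall u (f : X u -> R) (cf : continuous f) y,
      Theta u (toC cf) y = (f (psi u y))%:C%C.
Proof.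
move=> proxX minY [uTheta eTheta].
have st u y := ucp_Cfun_state y (uTheta u).
pose T u (f : X u -> R) (cf : continuous f) y := complex.Re (Theta u (toC cf) y).
have TE u f cf y : Theta u (toC cf) y = (@T u f cf y)%:C%C.
  exact: (state_toC (st u y) cf).
pose k u (f : X u -> R) (cf : continuous f) (p : Y u * X u) := T u f cf p.1 - f p.2.
have ck u f cf : continuous (@k u f cf).
  move=> p; apply: cvgB.
    apply: (@continuous_comp _ _ _ (@fst (Y u) (X u)) (T u f cf)).
      exact: cvg_fst.
    exact: CRe_cont.
  apply: (@continuous_comp _ _ _ (@snd (Y u) (X u)) f); last exact: cf.
  exact: cvg_snd.
(* This will be the graph of [psi u]: the pairs [(y, x)] for which the state [Theta u _ y] agrees
   with evaluation at [x] on real functions. *)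
pose K u : set (Y u * X u) := [set p | forall f (cf : continuous f), k u f cf p = 0].
have KE u y x : K u (y, x) <->
    forall f (cf : continuous f), Theta u (toC cf) y = (f x)%:C%C.
  split=> h f cf; first by rewrite TE; congr (_%:C)%C; apply/eqP; rewrite -subr_eq0; apply/eqP/(h f cf).
  by apply/eqP; rewrite /k subr_eq0 /T /= h.
have cptYX u : compact [set: Y u * X u].
  by rewrite -setXTT; apply: compact_setX; exact: compactT.
have cK u : compact (K u).
  apply: subclosed_compact (@cptYX u) _ => //.
  have -> : K u = \bigcap_(f in [set: {f : X u -> R | continuous f}])
      (k u (sval f) (proj2_sig f) @^-1` [set 0]).
    apply/seteqP; split=> [p Kp [f cf] _|p Kp f cf]; first exact: Kp.
    exact: (Kp (exist (fun f : X u -> R => continuous f) f cf) I).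
  apply: closed_bigI => -[f cf] _.
  apply: closed_comp => [p _|]; first exact: ck.
  exact: closed_eq.
have move_point u v (g : arrow u v) (f : X v -> R) (cf : continuous f) :
    exists cfg : continuous (fun x => f (sp_act g x)),
      forall y, Theta v (toC cf) (sp_act g y) = Theta u (toC cfg) y.
  have cfg : continuous (fun x => f (sp_act g x)).
    by move=> x; apply: (@continuous_comp _ _ _ (sp_act g) f);
      [exact: sp_act_cont|exact: cf].
  exists cfg => y.
  have -> : toC cf = C_act g (toC cfg).
    by apply: CfunP => x /=; rewrite sp_actVK.
  by rewrite -(eTheta _ _ g (toC cfg) I) /= sp_actK.
have Kact u v (g : arrow u v) y x : K u (y, x) -> K v (sp_act g y, sp_act g x).
  move=> /KE h; apply/KE => f cf.
  by have [cfg ->] := move_point _ _ g f cf; rewrite h.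
have K0 u : K u !=set0.
  pose y0 : Y u := point.
  have [mu muE] := state_radon (st u y0).
  have [|q [clx [x _ xE]]] := proxX u u mu; first by exists (gunit u).
  move: clx; rewrite -xE => clx.
  pose A := range (fun g : arrow u u => radon_act g mu).
  (* An arrow realising each measure of the orbit; off the orbit the unit is a dummy value. *)
  have /choice[gam gamE] (nu : radon_prob R (X u)) :
      exists g : arrow u u, A nu -> radon_act g mu = nu.
    have [[g _ gnu]|nA] := pselect (A nu); first by exists g.
    by exists (gunit u).
  (* By equivariance the state at [g y0] is integration against [g mu]. As [g mu] tends to the point
     mass at [x], every [k u f cf] tends to 0 along the pairs [(g y0, x)], and a cluster point of
     these pairs lies in [K u]. *)
  pose F := (fun nu => (sp_act (gam nu) y0, x)) @ (within A (nbhs (point_mass R x))).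
  have PF : ProperFilter F.
    by apply: fmap_proper_filter; exact: within_nbhs_proper.
  have [p [_ Fp]] := @cptYX u F PF filterT.
  exists p => f cf; apply: (cluster_eq0 (ck u f cf) Fp) => e e0.
  rewrite /F /fmap /= /within /=.
  have near_x : nbhs (point_mass R x) [set nu | `|rint (point_mass R x) f - rint nu f| < e].
    by have /(@cvgrPdist_lt _ R) := rint_continuous cf (x := point_mass R x); apply.
  apply: filterS near_x => nu; rewrite /= rint_point_mass // => fnu Anu.
  rewrite /k /T /=; have [cfg ->] := move_point _ _ (gam nu) f cf.
  by rewrite muE /= -(rint_push (@sp_act_cont G X u u (gam nu)) mu cf)
    -/(radon_act _ _) (gamE _ Anu) distrC.
pose Z u := @fst (Y u) (X u) @` K u.
have ZT u : Z u = setT.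
  apply: (minY Z); split=> [w|w v g].
    split; last by have [p Kp] := K0 w; exists p.1, p.
    apply: continuous_compact; last exact: cK.
    by apply: continuous_subspaceT => p; exact: cvg_fst.
  apply/seteqP; split=> [_ [_ [[y x] Kp <-] <-]|_ [[y x] Kp <-]] /=.
    by exists (sp_act g y, sp_act g x) => //; exact: Kact.
  exists (sp_act (ginv g) y); last by rewrite sp_actVK.
  by exists (sp_act (ginv g) y, sp_act (ginv g) x) => //; exact: Kact.
have psi_ex u (y : Y u) : exists x, K u (y, x).
  have : Z u y by rewrite ZT.
  by move=> [[y' x] Kp /= <-]; exists x.
pose psi u y := projT1 (cid (psi_ex u y)).
have psiK u y : K u (y, psi u y) by rewrite /psi; case: cid.
have psiE u f (cf : continuous f) y : Theta u (toC cf) y = (f (psi u y))%:C%C.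
  by have /KE := psiK u y; apply.
(* Uniqueness of the second coordinate, together with invariance of [K], makes the chosen [psi]
   equivariant. *)
have Kuniq u y x x' : K u (y, x) -> K u (y, x') -> x = x'.
  move=> /KE h /KE h'; apply: (@eq_by_functions R) => f cf.
  by have := h f cf; rewrite h' => -[].
exists psi; last exact: psiE.
split=> [u y|u v g y]; last first.
  by apply: (Kuniq v (sp_act g y)); [exact: Kact|exact: psiK].
move=> B; rewrite nbhsE => -[V [oV Vy] VB].
(* Continuity of [psi u]: the composite of [f] with [psi u] is the continuous function [T u f cf],
   and wherever it is positive [psi u] takes its value in [V]. *)
have [f [cf _ f0 f1]] := @urysohn_point R (X u) _ _ oV Vy.
have TpsiE y' : T u f cf y' = f (psi u y') by rewrite /T psiE.
have oT : open [set y' | 0 < T u f cf y'] by apply: cont_gt_open; exact: CRe_cont.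
have : nbhs y [set y' | 0 < T u f cf y'].
  by apply: open_nbhs_nbhs; split => //=; rewrite TpsiE f1.
apply: filterS => y' /=; rewrite TpsiE => fy; apply: VB; apply: contrapT => nV.
by move: fy; rewrite f0 // ltxx.
Qed.

Theorem theorem4p9 (R : realType) (G : groupoid) (dF dH : gspace G)
    (furstenberg_dF : furstenberg_boundary R dF)
    (hamana_dH : hamana_boundary R dH) :
  gisomorphic dF dH.
Proof.
have [[minF proxF] univF] := furstenberg_dF.
have minH := hamana_minimal hamana_dH.
have bH : gboundary R dH by split => //; exact: hamana_strongly_proximal.
have [phi [cphi ephi] _] := univF dH bH.
pose P : sys_map (C_system R dH) (C_system R dF) := fun u => C_map (cphi u).
have mP : sys_morphism P.
  split=> [u|u v g f _].
    by apply: star_hom_ucp => [f h|c f||f h|f]; exact: CfunP.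
  by apply: CfunP => x /=; rewrite ephi.
have [|Theta mTheta ThetaP] := @hamana_retraction R G dH (C_system R dF)
    (fun u f => f (point : dF u)) P hamana_dH _ mP.
  by move=> u; exact: star_hom_ucp.
have [psi [cpsi epsi] psiE] := morphism_gmap proxF minH mTheta.
(* The identity [Theta u (P u f) = f], evaluated at [y], reads [f (phi u (psi u y)) = f y], and
   continuous functions separate points. *)
have phiK u y : phi u (psi u y) = y.
  apply: (@eq_by_functions R) => f cf.
  have cfp : continuous (fun x => f (phi u x)).
    by move=> x; apply: (@continuous_comp _ _ _ (phi u) f); [exact: cphi|exact: cf].
  have := ThetaP u (toC cf).
  have -> : P u (toC cf) = toC cfp by exact: CfunP.
  by move=> /(congr1 (fun h : Cfun R (dH u) => h y)); rewrite psiE => -[].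
have imT u : range (psi u) = setT.
  apply: (minF (fun u => range (psi u))); split=> [w|w v g].
    split; last by exists (psi w point), point.
    apply: continuous_compact; last exact: compactT.
    by apply: continuous_subspaceT; exact: cpsi.
  apply/seteqP; split=> [_ [_ [y _ <-] <-]|_ [y _ <-]].
    by exists (sp_act g y); rewrite // epsi.
  exists (sp_act (ginv g) (psi v y)); last by rewrite sp_actVK.
  by exists (sp_act (ginv g) y); rewrite // epsi.
exists phi; first by split.
move=> u; split; first exact: cphi.
exists (psi u); first exact: cpsi.
split=> x; last exact: phiK.
have : range (psi u) x by rewrite imT.
by move=> [y _ <-]; rewrite phiK.
Qed.
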